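(* There exist constants $k_0$ and $r_0$ such that for all integers $k \ge k_0$ and $r \ge r_0$ satisfying $k \leq r \log^2 r$, we have $$s_r(K_{k}) \leq 2^{400}\, k^2\, r^{2+\frac{30}{k}}\, \log^{20} r\, \log^{20} k.$$
   Context: All graphs are finite and simple; $K_k$ is the complete graph on $k$ vertices. A graph $G$ is $r$-Ramsey for a graph $H$ if every coloring of the edges of $G$ with $r$ colors contains a monochromatic copy of $H$. A graph $G$ is $r$-Ramsey-minimal for $H$ if it is $r$-Ramsey for $H$ but no proper subgraph of $G$ is $r$-Ramsey for $H$. Let $\mathcal{M}_r(H)$ be the set of all $r$-Ramsey-minimal graphs for $H$. Define $s_r(H) := \min\{\delta(G) : G \in \mathcal{M}_r(H)\}$, where $\delta(G)$ is the minimum degree of $G$. Here $\log$ denotes the natural logarithm and $\log^a x = (\log x)^a$. *)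

(* Defs.v *)
From HB Require Import structures.
From mathcomp Require Import all_boot.

Set Implicit Arguments.
Unset Strict Implicit.
Unset Printing Implicit Defensive.

(* A graph carries its own vertex set inside an ambient finite type, so that
   subgraphs with fewer vertices live over the same ambient type. *)
Record graph (T : finType) := Graph {
  vertices : {set T};
  edges : {set {set T}};
  _ : [forall e in edges, (e \subset vertices) && (#|e| == 2)]
}.

Lemma graph_inj (T : finType) (F G : graph T) :
  vertices F = vertices G -> edges F = edges G -> F = G.
Proof.
case: F G => [V E p] [V' E' q] /= eV eE; subst V' E'.
by rewrite (bool_irrelevance p q).
Qed.

Definition subgraph (T : finType) (F G : graph T) : Prop :=
  vertices F \subset vertices G /\ edges F \subset edges G.

Definition proper_subgraph (T : finType) (F G : graph T) : Prop :=
  subgraph F G /\ F <> G.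

Definition degree (T : finType) (G : graph T) (v : T) : nat :=
  #|[set e in edges G | v \in e]|.

(* Every degree is smaller than #|vertices G|, so the default value of the
   minimum is reached only by the graph without vertices. *)
Definition min_degree (T : finType) (G : graph T) : nat :=
  \big[minn/#|vertices G|]_(v in vertices G) degree G v.

Lemma complete_subproof (k : nat) :
  [forall e in [set e : {set 'I_k} | #|e| == 2],
     (e \subset [set: 'I_k]) && (#|e| == 2)].
Proof. by apply/forall_inP => e; rewrite inE subsetT. Qed.

Definition complete (k : nat) : graph 'I_k := Graph (complete_subproof k).

(* The values of c outside edges G are irrelevant. *)
Definition edge_coloring (T : finType) (r : nat) (G : graph T)
    (c : {set T} -> nat) : Prop :=
  forall e, e \in edges G -> c e < r.

Definition monochromatic_copy (U T : finType) (H : graph U) (G : graph T)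
    (c : {set T} -> nat) : Prop :=
  exists (f : U -> T) (i : nat),
    [/\ {in vertices H &, injective f},
        forall u, u \in vertices H -> f u \in vertices G
      & forall e, e \in edges H -> f @: e \in edges G /\ c (f @: e) = i].

Definition ramsey (r : nat) (U : finType) (H : graph U)
    (T : finType) (G : graph T) : Prop :=
  forall c, edge_coloring r G c -> monochromatic_copy H G c.

Definition ramsey_minimal (r : nat) (U : finType) (H : graph U)
    (T : finType) (G : graph T) : Prop :=
  ramsey r H G /\ forall F, proper_subgraph F G -> ~ ramsey r H F.

Definition minimal_ramsey_degree (r : nat) (U : finType) (H : graph U)
    (d : nat) : Prop :=
  exists (T : finType) (G : graph T), ramsey_minimal r H G /\ min_degree G = d.

(* s_r(H) = d. A relation rather than a function to nat, so that no default
   value is needed in case there is no r-Ramsey-minimal graph for H. *)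
Definition is_s (r : nat) (U : finType) (H : graph U) (d : nat) : Prop :=
  minimal_ramsey_degree r H d /\
  forall m, minimal_ramsey_degree r H m -> d <= m.

(* Main.v *)
Require Import Defs.
From HB Require Import structures.
From mathcomp Require Import all_boot all_order all_algebra all_field.
From mathcomp Require Import zify ring lra.
From mathcomp Require Import boolp reals exp.

Set Implicit Arguments.
Unset Strict Implicit.
Unset Printing Implicit Defensive.

Import Order.TTheory GRing.Theory Num.Theory.

(** Let G be a minimal Ramsey graph inside a graph consisting of a base that is
    not Ramsey together with extra "apex" vertices of degree at most n. Then G
    contains an apex vertex, so its minimum degree is at most n.  The base comes
    from a Nesetril-Rodl type theorem, proved by the partite construction for
    homomorphisms instead of embeddings (this suffices, because homomorphisms are
    injective on cliques): every colouring of the base contains a homomorphic copy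
    of a prescribed edge-coloured graph D without monochromatic K_k, with the
    colours permuted. Any D such that each vertex colouring of its n vertices has
    a K_(k-1) whose edges and vertices all have the same colour gives apex
    vertices that make the graph Ramsey.

    The edges of D are those of an affine plane over a field with q = 2^m
    elements. The lines of d slopes form a class, one class per edge colour. Every
    incident point-line pair receives a random label in {0, ..., K-1}, K = k Q;
    two points are joined if their labels on the common line are distinct and
    smaller than k-1.
    - A vertex colouring is bad with probability at most
      ((k-1) (1-1/K)^d)^(q^2), and there are r^(q^2) of them.
    - A monochromatic K_k is a set S of k points, not on a line and spanning only
      lines of one class. It needs one small label for each incidence of a point
      of S with a line spanned by S, each of probability at most 1/Q. The sum of
      Q^(-number of incidences) over these S is estimated by adding the points
      one at a time: a new point either lies on at least V lines joining it to
      the previous points, or it lies on one of the at most 2 V^2 lines that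
      contain at least the fraction 1/V of them. *)

(** * The Hales-Jewett theorem *)

(** A combinatorial line is a word over [option T] in which [None] marks the moving coordinates;
    [active] asks for at least one of them. *)
Definition line_point (I T : finType) (w : {ffun I -> option T}) (a : T) : {ffun I -> T} :=
  [ffun i => odflt a (w i)].

Definition active (I T : finType) (w : {ffun I -> option T}) : bool :=
  [exists i, w i == None].

Definition cat_word (I J : finType) (X : Type) (u : {ffun I -> X}) (v : {ffun J -> X}) :
    {ffun I + J -> X} :=
  [ffun z => match z with inl i => u i | inr j => v j end].

Definition const_line (I T : finType) (u : {ffun I -> T}) : {ffun I -> option T} :=
  [ffun i => Some (u i)].

Lemma line_point_cat (I J T : finType) (u : {ffun I -> option T}) (v : {ffun J -> option T}) a :
  line_point (cat_word u v) a = cat_word (line_point u a) (line_point v a).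
Proof. by apply/ffunP => -[i|j]; rewrite !ffunE. Qed.

Lemma line_point_const (I T : finType) (u : {ffun I -> T}) a :
  line_point (const_line u) a = u.
Proof. by apply/ffunP => i; rewrite !ffunE. Qed.

Lemma active_catl (I J T : finType) (u : {ffun I -> option T}) (v : {ffun J -> option T}) :
  active u -> active (cat_word u v).
Proof. by move=> /existsP[i /eqP ui]; apply/existsP; exists (inl i); rewrite ffunE ui. Qed.

Lemma active_catr (I J T : finType) (u : {ffun I -> option T}) (v : {ffun J -> option T}) :
  active v -> active (cat_word u v).
Proof. by move=> /existsP[i /eqP ui]; apply/existsP; exists (inr i); rewrite ffunE ui. Qed.

Definition mono_on (I T K : finType) (s : seq T) (C : {ffun I -> T} -> K)
    (w : {ffun I -> option T}) :=
  active w /\ {in s &, forall a b, C (line_point w a) = C (line_point w b)}.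

(* [L] is a colour-focused family: all its lines pass through the same point at
   the letter [b], and they are monochromatic on [b0 :: s] in distinct colours. *)
Definition focused (I T K : finType) (b b0 : T) (s : seq T) (C : {ffun I -> T} -> K)
    (f : {ffun I -> T}) (L : seq {ffun I -> option T}) :=
  [/\ forall w, w \in L -> mono_on (b0 :: s) C w,
      forall w, w \in L -> line_point w b = f
    & uniq [seq C (line_point w b0) | w <- L]].

(** Colour focusing, by induction on [m]. Colouring the first block by functions of the second gives
    a line [w] along which only the letter [b] can change the colour; the induction hypothesis is
    applied to [C'] on the second block. If the focus [f] has the colour of an old line, that line
    extends to the letter [b]; otherwise [w] followed by the constant word [f] is a further line
    with a new colour. *)
Lemma hales_jewett_focused (T K : finType) (b b0 : T) (s : seq T) :
  (forall K' : finType, exists I : finType, forall C : {ffun I -> T} -> K',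
     exists w, mono_on (b0 :: s) C w) ->
  forall m : nat, exists I : finType, forall C : {ffun I -> T} -> K,
    (exists w, mono_on (b :: b0 :: s) C w) \/
    (exists f L, size L = m /\ focused b b0 s C f L).
Proof.
move=> HJ; elim=> [|m [J HJm]].
  exists unit => C; right; exists [ffun => b0], [::]; split=> //.
have [I HI] := HJ {ffun {ffun J -> T} -> K}.
exists (I + J)%type => C.
have [w [wa wm]] := HI (fun u => [ffun v => C (cat_word u v)]).
have {}wm a v : a \in b0 :: s ->
    C (cat_word (line_point w a) v) = C (cat_word (line_point w b0) v).
  move=> sa; have /ffunP/(_ v) := wm a b0 sa (mem_head _ _).
  by rewrite !ffunE.
pose C' v := C (cat_word (line_point w b0) v).
have lift_mono w' : mono_on (b :: b0 :: s) C' w' ->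
    exists w0, mono_on (b :: b0 :: s) C w0.
  move=> [aw' mw']; exists (cat_word (const_line (line_point w b0)) w').
  split; first exact: active_catr.
  by move=> x y sx sy; rewrite !line_point_cat !line_point_const; exact: mw'.
have [[w' /lift_mono]|[f [L [sL [Lm Lf Lu]]]]] := HJm C'; first by left.
have [/mapP[w' Lw' Cf]|nCf] := boolP (C' f \in [seq C' (line_point w0 b0) | w0 <- L]).
  left; apply: (lift_mono w'); have [aw' mw'] := Lm _ Lw'; split=> //.
  have P x : x \in b :: b0 :: s -> C' (line_point w' x) = C' (line_point w' b0).
    by rewrite inE => /predU1P[->|sx]; [rewrite Lf|apply: mw' => //; exact: mem_head].
  by move=> x y /P -> /P ->.
right; exists (cat_word (line_point w b) f).
exists (cat_word w (const_line f) :: [seq cat_word w w' | w' <- L]).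
split; first by rewrite /= size_map sL.
split.
- move=> w'; rewrite inE => /predU1P[->|/mapP[w0 Lw0 ->]].
    split=> [|x y sx sy]; first exact: active_catl.
    by rewrite !line_point_cat !line_point_const !(wm _ _ sx, wm _ _ sy).
  split=> [|x y sx sy]; first exact: active_catl.
  rewrite !line_point_cat !(wm _ _ sx, wm _ _ sy).
  by have [_] := Lm _ Lw0; exact.
- move=> w'; rewrite inE => /predU1P[->|/mapP[w0 Lw0 ->]].
    by rewrite line_point_cat line_point_const.
  by rewrite line_point_cat Lf.
- rewrite /= line_point_cat line_point_const -map_comp.
  rewrite (_ : map _ L = [seq C' (line_point w0 b0) | w0 <- L]); last first.
    by apply: eq_map => w0 /=; rewrite line_point_cat.
  by rewrite Lu andbT.
Qed.

Lemma hales_jewett_seq (T : finType) (s : seq T) (K : finType) :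
  exists I : finType, forall C : {ffun I -> T} -> K, exists w, mono_on s C w.
Proof.
have triv (s' : seq T) : (forall a b, a \in s' -> b \in s' -> a = b) ->
    forall K : finType, exists I : finType, forall C : {ffun I -> T} -> K,
    exists w, mono_on s' C w.
  move=> P K'; exists unit => C; exists [ffun => None].
  split; first by apply/existsP; exists tt; rewrite ffunE.
  by move=> a b sa sb; rewrite (P a b).
elim: s K => [|b [|b0 s] IH] K; first exact: triv.
  by apply: triv => x y; rewrite !inE => /eqP-> /eqP->.
(* There are only [#|K|] colours, so a focused family of [#|K|.+1] lines cannot exist. *)
have [I HI] := @hales_jewett_focused T K b b0 s IH #|K|.+1.
exists I => C; have [//|[f [L [sL [_ _ Lu]]]]] := HI C.
have := max_card [in [seq C (line_point w b0) | w <- L]].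
by rewrite (card_uniqP Lu) size_map sL ltnn.
Qed.

Theorem hales_jewett (T K : finType) :
  exists I : finType, forall C : {ffun I -> T} -> K, exists w : {ffun I -> option T},
    active w /\ forall a b, C (line_point w a) = C (line_point w b).
Proof.
have [I HI] := hales_jewett_seq (enum T) K; exists I => C.
have [w [aw mw]] := HI C; exists w; split=> // a b.
by apply: mw; rewrite mem_enum.
Qed.

(** * The partite construction *)

Definition symmetric_fun (T X : Type) (c : T -> T -> X) := forall x y, c x y = c y x.

(** [None] means that there is no edge. The map [h] may be constant, so a loop counts as a clique
    and [clique_free] excludes loops. *)
Definition clique (k : nat) (C T : Type) (c : T -> T -> option C) (j : C) (h : 'I_k -> T) :=
  forall a b, a != b -> c (h a) (h b) = Some j.

Definition clique_free (k : nat) (C T : Type) (c : T -> T -> option C) :=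
  forall j (h : 'I_k -> T), ~ clique c j h.

Definition color_hom (C T T' : Type) (c : T -> T -> option C) (c' : T' -> T' -> option C)
    (f : T -> T') :=
  forall x y j, c x y = Some j -> c' (f x) (f y) = Some j.

Definition partite (C T N : Type) (c : T -> T -> option C) (pi : T -> N) :=
  forall x y j, c x y = Some j -> pi x <> pi y.

Section PartiteStep.
Variables (k : nat) (C T N I : finType) (c : T -> T -> option C) (pi : T -> N).
Variables (p q : N) (i : C).
Hypotheses (k_gt2 : 2 < k) (c_sym : symmetric_fun c) (c_free : clique_free k c).
Hypothesis c_part : partite c pi.

(** The alphabet for Hales-Jewett: edges of colour [i] oriented from part [p] to part [q]. *)
Definition pq_edge := {e : T * T | [&& pi e.1 == p, pi e.2 == q & c e.1 e.2 == Some i]}.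

Definition pq_line := {w : {ffun I -> option pq_edge} | active w}.

Definition amalgam := (N * {ffun I -> T} * option pq_line)%type.

(* The last component is [None] on the parts [p] and [q], which the copies share,
   and [Some w] elsewhere, where the copies are disjoint; there the word in the
   second component serves only to make [line_embed w] injective. *)
Definition line_embed (w : pq_line) (x : T) : amalgam :=
  (pi x,
   [ffun t => match sval w t with
              | None => x
              | Some e => if pi x == p then (sval e).1
                          else if pi x == q then (sval e).2 else x
              end],
   if (pi x == p) || (pi x == q) then None else Some w).

(** The colour is read off in any copy containing both points; by [line_embed_color] the choice does
    not matter. *)
Definition amalgam_color (u v : amalgam) : option C :=
  if [pick z : pq_line * T * T |
       [&& u == line_embed z.1.1 z.1.2, v == line_embed z.1.1 z.2 & c z.1.2 z.2 != None]]
  is Some z then c z.1.2 z.2 else None.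

Lemma line_embed_inj w : injective (line_embed w).
Proof.
move=> x y [_ /ffunP]; have /existsP[t /eqP wt] := valP w.
by move=> /(_ t); rewrite !ffunE wt.
Qed.

Lemma line_embed_pi w x : (line_embed w x).1.1 = pi x.
Proof. by []. Qed.

Lemma pq_edgeP (e : pq_edge) :
  [/\ pi (sval e).1 = p, pi (sval e).2 = q & c (sval e).1 (sval e).2 = Some i].
Proof. by case: e => e /= /and3P[/eqP ? /eqP ? /eqP ?]. Qed.

(* If two copies share both end points of an edge, then, away from the common
   active coordinates, both edges are the colour-[i] constants of the other line. *)
Lemma line_embed_color w w' x y x' y' j :
  line_embed w x = line_embed w' x' -> line_embed w y = line_embed w' y' ->
  c x' y' = Some j -> c x y = Some j.
Proof.
move=> ex ey cj.
have [pix piy] : pi x = pi x' /\ pi y = pi y'.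
  by rewrite -(line_embed_pi w x) -(line_embed_pi w y) ex ey.
have same_line : w = w' -> c x y = Some j.
  by move=> ww; move: ex ey; rewrite ww => /line_embed_inj-> /line_embed_inj->.
have [|xN] := boolP ((pi x == p) || (pi x == q)); last first.
  by apply: same_line; case: ex => _ _; rewrite -pix (negbTE xN); case.
have [|yN xpq] := boolP ((pi y == p) || (pi y == q)); last first.
  by apply: same_line; case: ey => _ _; rewrite -piy (negbTE yN); case.
move=> ypq xpq; have /eqP pixy : pi x <> pi y by rewrite pix piy; exact: c_part cj.
have {ex}ex t : (line_embed w x).1.2 t = (line_embed w' x').1.2 t by rewrite ex.
have {ey}ey t : (line_embed w y).1.2 t = (line_embed w' y').1.2 t by rewrite ey.
have const (e : pq_edge) :
    c (if pi x == p then (sval e).1 else if pi x == q then (sval e).2 else x)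
      (if pi y == p then (sval e).1 else if pi y == q then (sval e).2 else y) = Some i.
  have [_ _ ce] := pq_edgeP e.
  move: xpq ypq pixy; have [->|xp] := eqVneq (pi x) p.
    by move=> _ /orP[/eqP->|/eqP->]; rewrite eqxx // => /negbTE; rewrite eq_sym => ->.
  move=> /= /eqP->; rewrite eqxx; have [-> _ _|yp] := eqVneq (pi y) p.
    by rewrite c_sym.
  by move=> /= /eqP->; rewrite eqxx.
have const' (e : pq_edge) :
    c (if pi x' == p then (sval e).1 else if pi x' == q then (sval e).2 else x')
      (if pi y' == p then (sval e).1 else if pi y' == q then (sval e).2 else y') = Some i.
  have := const e; rewrite -pix -piy.
  by case/orP: xpq => ->; case/orP: ypq => ->; repeat case: ifP.
have /existsP[t /eqP wt] := valP w.
have := (ex t, ey t); rewrite !ffunE wt; case E: (sval w' t) => [e|]; last first.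
  by case=> -> ->.
case=> xe ye; have cxy : c x y = Some i by rewrite xe ye const'.
rewrite cxy; have /existsP[t' /eqP wt'] := valP w'.
have := (ex t', ey t'); rewrite !ffunE wt'; case E': (sval w t') => [e'|]; last first.
  by case=> x2 y2; rewrite -cj -x2 -y2 cxy.
by case=> x2 y2; rewrite -cj -x2 -y2 const.
Qed.

Lemma amalgam_color_embed w x y : amalgam_color (line_embed w x) (line_embed w y) = c x y.
Proof.
rewrite /amalgam_color; case: pickP => [[[w' x'] y'] /= /and3P[/eqP ex /eqP ey]|].
  by case E: (c x' y') => [j|] // _; rewrite (line_embed_color ex ey E).
by move=> /(_ (w, x, y)); rewrite /= !eqxx /=; case: (c x y).
Qed.

Lemma amalgam_colorP u v j : amalgam_color u v = Some j ->
  exists w x y, [/\ u = line_embed w x, v = line_embed w y & c x y = Some j].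
Proof.
rewrite /amalgam_color; case: pickP => // -[[w x] y] /= /and3P[/eqP-> /eqP-> _] cj.
by exists w, x, y.
Qed.

Lemma amalgam_color_sym : symmetric_fun amalgam_color.
Proof.
have half u v j : amalgam_color u v = Some j -> amalgam_color v u = Some j.
  by move=> /amalgam_colorP[w [x [y [-> -> cj]]]]; rewrite amalgam_color_embed c_sym.
move=> u v; case E: (amalgam_color u v) => [j|]; first by rewrite (half _ _ _ E).
by case E': (amalgam_color v u) => [j|] //; rewrite (half _ _ _ E') in E.
Qed.

Lemma amalgam_partite : partite amalgam_color (fun u : amalgam => u.1.1).
Proof. by move=> u v j /amalgam_colorP[w [x [y [-> -> /c_part]]]]. Qed.

(* A clique has a vertex outside the parts [p] and [q]; this vertex and all its
   neighbours lie in a single copy. *)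
Lemma amalgam_clique_free : clique_free k amalgam_color.
Proof.
move=> j h hcl.
have pi_inj a b : a != b -> (h a).1.1 != (h b).1.1.
  by move=> /hcl/amalgam_partite/eqP.
have k_gt0 : 0 < k by apply: leq_trans k_gt2.
pose o n (l : n < k) := Ordinal l.
have [a aN] : exists a, ((h a).1.1 != p) && ((h a).1.1 != q).
  apply/existsP; apply: contraLR k_gt2; rewrite negb_exists -leqNgt => /forallP H.
  rewrite -[k]card_ord -cardsT.
  have inj : injective (fun a => (h a).1.1).
    by move=> a b; apply: contra_eq => /pi_inj.
  rewrite -(card_imset _ inj); apply: leq_trans (_ : #|[set p; q]| <= _).
    apply: subset_leq_card; apply/subsetP => _ /imsetP[a _ ->].
    by have := H a; rewrite negb_and !negbK !inE.
  by rewrite cards2; case: eqP.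
have [b bP] : exists b, b != a.
  have := k_gt2; case: (eqVneq a (o 0 k_gt0)) => [->|].
    by move=> _; exists (o 1 (ltnW k_gt2)); rewrite -val_eqE.
  by exists (o 0 k_gt0); rewrite eq_sym.
have [w [x [_ [hax _ _]]]] := amalgam_colorP (hcl b a bP).
have [w0 [_ [x0 [_ hax0 _]]]] := amalgam_colorP (hcl b a bP).
have ha2 : (h a).2 = Some w0.
  rewrite hax0 /=; move: aN; rewrite hax0 /= => /andP[/negbTE-> /negbTE->] //.
have img d : exists y, h d == line_embed w0 y.
  have [->|da] := eqVneq d a; first by exists x0; rewrite hax0.
  have [w1 [y [y0 [-> ha1 _]]]] := amalgam_colorP (hcl d a da).
  exists y; move: ha2; rewrite ha1 /=; case: ifP => // _ [->].
  by [].
pose g d := xchoose (img d).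
have gP d : h d = line_embed w0 (g d) by apply/eqP/(xchooseP (img d)).
apply: (c_free (j := j) (h := g)) => d e de.
by rewrite -(amalgam_color_embed w0) -!gP; exact: hcl.
Qed.

End PartiteStep.

(** Each word over [pq_edge] is an edge of the amalgam between parts [p] and [q], so [chi] colours
    the words. A monochromatic line of words is a copy of [T] whose edges of colour [i] from [p] to
    [q] all get the same value of [chi]. *)
Lemma partite_step (k : nat) (C T N K : finType) (c : T -> T -> option C) (pi : T -> N)
    (p q : N) (i : C) :
  2 < k -> symmetric_fun c -> clique_free k c -> partite c pi -> p != q ->
  exists (T' : finType) (c' : T' -> T' -> option C) (pi' : T' -> N),
    [/\ symmetric_fun c', clique_free k c', partite c' pi' &
     forall chi : T' -> T' -> K, exists f : T -> T',
       [/\ color_hom c c' f, forall x, pi' (f x) = pi x &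
        forall x y x' y', pi x = p -> pi y = q -> c x y = Some i ->
          pi x' = p -> pi y' = q -> c x' y' = Some i ->
          chi (f x) (f y) = chi (f x') (f y')]].
Proof.
move=> k_gt2 c_sym c_free c_part pq.
have [I HI] := hales_jewett (pq_edge c pi p q i) K.
exists (amalgam I c pi p q i), (@amalgam_color _ _ _ I c pi p q i), (fun u => u.1.1).
split; [exact: amalgam_color_sym|exact: amalgam_clique_free|exact: amalgam_partite|].
move=> chi.
pose pt (u : {ffun I -> pq_edge c pi p q i}) : amalgam I c pi p q i * amalgam I c pi p q i :=
  ((p, [ffun t => (sval (u t)).1], None), (q, [ffun t => (sval (u t)).2], None)).
have [w [aw mw]] := HI (fun u => chi (pt u).1 (pt u).2).
exists (line_embed (exist _ w aw)); split=> //.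
  by move=> x y j; rewrite amalgam_color_embed.
have ptP x y (h : [&& pi x == p, pi y == q & c x y == Some i]) :
    pt (line_point w (exist _ (x, y) h)) =
    (line_embed (exist _ w aw) x, line_embed (exist _ w aw) y).
  case/and3P: (h) => /eqP xp /eqP yq _; congr (_, _).
  - rewrite /line_embed xp eqxx /=; congr (_, _, _).
    by apply/ffunP => t; rewrite !ffunE /=; case: (w t).
  - rewrite /line_embed yq eq_sym (negbTE pq) eqxx /=; congr (_, _, _).
    by apply/ffunP => t; rewrite !ffunE /=; case: (w t).
move=> x y x' y' xp yq cxy xp' yq' cxy'.
have h : [&& pi x == p, pi y == q & c x y == Some i] by rewrite xp yq cxy !eqxx.
have h' : [&& pi x' == p, pi y' == q & c x' y' == Some i] by rewrite xp' yq' cxy' !eqxx.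
by have := mw (exist _ (x, y) h) (exist _ (x', y') h'); rewrite !ptP.
Qed.

(** * Ramsey's theorem for pairs *)

Lemma pigeonhole_fiber (T : eqType) (K : finType) (s : seq T) (f : T -> K) (n : nat) :
  #|K| * n < size s -> exists kappa, n < count (fun x => f x == kappa) s.
Proof.
move=> sz; apply/existsP; apply: contraLR sz; rewrite negb_exists -leqNgt => /forallP H.
rewrite -(size_map f) -[leqLHS]sum1_size.
rewrite (partition_big id xpredT) //= -sum_nat_const; apply: leq_sum => kappa _.
by have := H kappa; rewrite -leqNgt sum1_count count_map.
Qed.

(** The first point is kept together with a large class of later points that it sees in one colour,
    and the choice is repeated inside this class. *)
Lemma ramsey_first_determined (K : finType) (m : nat) : exists n, forall (T : eqType)
  (psi : T -> T -> K) (s : seq T), n <= size s ->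
  exists s' : seq (T * K), [/\ size s' = m, subseq (unzip1 s') s &
    pairwise (fun u v => psi u.1 v.1 == u.2) s'].
Proof.
elim: m => [|m [n IH]]; first by exists 0 => T psi s _; exists [::]; split=> //; exact: sub0seq.
exists (#|K| * n).+2 => T psi [//|x s] /= sz.
have [kappa ns] := @pigeonhole_fiber _ K s (psi x) n sz.
have [|s' [sz' sub' pw']] := IH _ psi [seq y <- s | psi x y == kappa].
  by rewrite size_filter ltnW.
exists ((x, kappa) :: s'); split=> /=; first by rewrite sz'.
- by rewrite eqxx; apply: subseq_trans sub' _; exact: filter_subseq.
- rewrite pw' andbT; apply/allP => u us'.
  have := mem_subseq sub' (map_f fst us'); rewrite mem_filter => /andP[] //.
Qed.

(** A second pigeonhole, on the colours attached to the first points. Sequences keep the order of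
    the points, which matters because [psi] need not be symmetric. *)
Lemma ramsey_pairs (K : finType) (m : nat) : exists n, forall (T : eqType)
  (psi : T -> T -> K) (s : seq T), n <= size s ->
  exists s' kappa, [/\ size s' = m.+1, subseq s' s & pairwise (fun u v => psi u v == kappa) s'].
Proof.
have [n Hn] := ramsey_first_determined K (#|K| * m).+1; exists n => T psi s sz.
have [s1 [sz1 sub1 pw1]] := Hn _ psi s sz.
have [|kappa mk] := @pigeonhole_fiber _ K s1 snd m; first by rewrite sz1.
pose s2 := take m.+1 [seq u <- s1 | u.2 == kappa].
have s21 : subseq s2 s1 by apply: subseq_trans (take_subseq _ _) (filter_subseq _ _).
exists (unzip1 s2), kappa; split.
- by rewrite size_map size_takel ?size_filter.
- exact: subseq_trans (map_subseq _ s21) sub1.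
- rewrite pairwise_map.
  have := subseq_pairwise s21 pw1; apply: (@sub_in_pairwise _ [pred u : T * K | u.2 == kappa]).
    by move=> u v; rewrite !inE => /eqP<-.
  by apply/allP => u /mem_take; rewrite mem_filter => /andP[].
Qed.

(** * Iteration of the partite step over pairs of parts and over colours *)

Lemma partite_steps (k : nat) (C T N K : finType) (c : T -> T -> option C) (pi : T -> N)
    (i : C) (l : seq (N * N)) :
  2 < k -> symmetric_fun c -> clique_free k c -> partite c pi ->
  exists (T' : finType) (c' : T' -> T' -> option C) (pi' : T' -> N),
    [/\ symmetric_fun c', clique_free k c', partite c' pi' &
     forall chi : T' -> T' -> K, exists f : T -> T',
       [/\ color_hom c c' f, forall x, pi' (f x) = pi x &
        forall x y x' y', (pi x, pi y) \in l -> pi x' = pi x -> pi y' = pi y ->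
          c x y = Some i -> c x' y' = Some i -> chi (f x) (f y) = chi (f x') (f y')]].
Proof.
move=> k_gt2; elim: l T c pi => [|[p q] l IH] T c pi c_sym c_free c_part.
  by exists T, c, pi; split=> // chi; exists id; split.
have [T1 [c1 [pi1 [sym1 free1 part1 H1]]]] := IH T c pi c_sym c_free c_part.
have [E|pq] := eqVneq p q.
  exists T1, c1, pi1; split=> // chi; have [f [f1 f2 f3]] := H1 chi; exists f; split=> //.
  move=> x y x' y'; rewrite inE => /predU1P[[px py]|]; last exact: f3.
  by move=> _ _ /c_part; rewrite px py E.
have [T2 [c2 [pi2 [sym2 free2 part2 H2]]]] :=
  partite_step K i k_gt2 sym1 free1 part1 pq.
exists T2, c2, pi2; split=> // chi.
have [g [g1 g2 g3]] := H2 chi.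
(* The pairs in [l] are made uniform for the pull-back of [chi] along [g], so their uniformity
   survives the composition. *)
have [f [f1 f2 f3]] := H1 (fun x y => chi (g x) (g y)).
exists (g \o f); split=> [x y j /f1/g1//|x|x y x' y']; first by rewrite /= g2 f2.
rewrite inE => /predU1P[[px py]|]; last exact: f3.
by move=> px' py' /f1 cf /f1 cf'; apply: g3; rewrite ?f2 ?px' ?py'.
Qed.

(* The initial partite system consists of one transversal copy of [T] for each
   map from [T] to the set of parts. *)
Lemma nesetril_rodl_color (k : nat) (C T K : finType) (c : T -> T -> option C) (i : C) :
  2 < k -> symmetric_fun c -> clique_free k c ->
  exists (T' : finType) (c' : T' -> T' -> option C),
    [/\ symmetric_fun c', clique_free k c' &
     forall chi : T' -> T' -> K, symmetric_fun chi -> exists f : T -> T',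
       color_hom c c' f /\
        forall x y x' y', c x y = Some i -> c x' y' = Some i ->
          chi (f x) (f y) = chi (f x') (f y')].
Proof.
move=> k_gt2 c_sym c_free.
have [n Hn] := ramsey_pairs (option K) #|T|.
pose N := 'I_n.
pose c0 (u v : {ffun T -> N} * T) : option C :=
  if (u.1 == v.1) && (u.1 u.2 != v.1 v.2) then c u.2 v.2 else None.
pose pi0 (u : {ffun T -> N} * T) := u.1 u.2.
have c0P u v j : c0 u v = Some j ->
    [/\ u.1 = v.1, u.1 u.2 != v.1 v.2 & c u.2 v.2 = Some j].
  by rewrite /c0; case: ifP => // /andP[/eqP-> ?].
have sym0 : symmetric_fun c0.
  by move=> u v; rewrite /c0 c_sym eq_sym [u.1 u.2 == _]eq_sym.
have free0 : clique_free k c0.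
  by move=> j h hcl; apply: (c_free j (fun a => (h a).2)) => a b /hcl/c0P[].
have part0 : partite c0 pi0 by move=> u v j /c0P[_ /eqP].
have [T' [c' [pi' [sym' free' part' H']]]] :=
  partite_steps K i (enum {: N * N}) k_gt2 sym0 free0 part0.
exists T', c'; split=> // chi chi_sym.
have [f [f1 f2 f3]] := H' chi.
pose edge_over (p q : N) (z : ({ffun T -> N} * T) * ({ffun T -> N} * T)) :=
  [&& pi0 z.1 == p, pi0 z.2 == q & c0 z.1 z.2 == Some i].
(* On edges of colour [i] the value of [chi] now depends only on the pair of parts; [None] stands
   for pairs of parts without such an edge. *)
pose psi (p q : N) : option K :=
  if [pick z | edge_over p q z] is Some z then Some (chi (f z.1) (f z.2)) else None.
have psiP u v : c0 u v = Some i -> psi (pi0 u) (pi0 v) = Some (chi (f u) (f v)).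
  move=> cuv; rewrite /psi; case: pickP => [[u' v'] /= /and3P[/eqP pu /eqP pv /eqP cuv']|].
    by congr Some; apply: f3; rewrite ?mem_enum ?pu ?pv.
  by move=> /(_ (u, v)); rewrite /edge_over /= cuv !eqxx.
have [|s [kappa [sz sub pw]]] := Hn _ psi (enum N); first by rewrite size_enum_ord.
have us : uniq s by apply: subseq_uniq sub _; exact: enum_uniq.
have [x0 _|T0] := pickP T; last first.
  have no_vertex (x : T) : False by have := T0 x.
  by exists (fun x => False_rect T' (no_vertex x)); split=> [x|i' x]; case: (no_vertex x).
have n0 : N by case: (s) sz => [|z s'] //.
(* The transversal copy whose vertices, in the order of [enum_rank], lie in the homogeneous parts
   [s]. *)
pose g : {ffun T -> N} := [ffun x => nth n0 s (enum_rank x)].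
have szr (x : T) : enum_rank x < size s by rewrite sz ltnW // ltnS ltn_ord.
have g_inj x y : x != y -> g x != g y.
  by rewrite !ffunE nth_uniq // => xy; apply: contra xy => /eqP/val_inj/enum_rank_inj->.
have c0g x y j : c x y = Some j -> c0 (g, x) (g, y) = Some j.
  move=> cxy; rewrite /c0 /= eqxx g_inj //=; apply/eqP => xy.
  apply: (c_free j (fun=> x)) => a b _; by rewrite -xy in cxy; exact: cxy.
exists (fun x => f (g, x)); split=> [x y j /c0g/f1 //|].
have chiP x y : c x y = Some i -> Some (chi (f (g, x)) (f (g, y))) = kappa.
  have lt z w : c z w = Some i -> enum_rank z < enum_rank w ->
      Some (chi (f (g, z)) (f (g, w))) = kappa.
    move=> /c0g/psiP <- zw; apply/eqP; rewrite /pi0 /= !ffunE.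
    by move/pairwiseP : pw => /(_ n0); apply; rewrite ?inE.
  move=> cxy; have [xy|xy|/val_inj/enum_rank_inj xy] := ltngtP (enum_rank x) (enum_rank y).
  - exact: lt.
  - by rewrite chi_sym; apply: lt => //; rewrite c_sym.
  - have /psiP/esym := c0g _ _ _ cxy; move: (c0g _ _ _ cxy) => /c0P[_ /=].
    by rewrite xy eqxx.
by move=> x y x' y' /chiP + /chiP e; rewrite -e; case.
Qed.

Lemma nesetril_rodl (k : nat) (C T K : finType) (c : T -> T -> option C) :
  2 < k -> symmetric_fun c -> clique_free k c ->
  exists (T' : finType) (c' : T' -> T' -> option C),
    [/\ symmetric_fun c', clique_free k c' &
     forall chi : T' -> T' -> K, symmetric_fun chi -> exists f : T -> T',
       color_hom c c' f /\
        forall i x y x' y', c x y = Some i -> c x' y' = Some i ->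
          chi (f x) (f y) = chi (f x') (f y')].
Proof.
move=> k_gt2 c_sym c_free.
suff [T' [c' [s' f' H']]] : exists (T' : finType) (c' : T' -> T' -> option C),
    [/\ symmetric_fun c', clique_free k c' &
     forall chi : T' -> T' -> K, symmetric_fun chi -> exists f : T -> T',
       color_hom c c' f /\
        forall i x y x' y', i \in enum C -> c x y = Some i -> c x' y' = Some i ->
          chi (f x) (f y) = chi (f x') (f y')].
  exists T', c'; split=> // chi /H'[f [f1 f2]]; exists f; split=> // i x y x' y'.
  by apply: f2; rewrite mem_enum.
elim: (enum C) => [|i l [T1 [c1 [sym1 free1 H1]]]].
  by exists T, c; split=> // chi _; exists id; split.
have [T2 [c2 [sym2 free2 H2]]] := nesetril_rodl_color K i k_gt2 sym1 free1.
exists T2, c2; split=> // chi chi_sym.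
have [g [g1 g2]] := H2 chi chi_sym.
have [|f [f1 f2]] := H1 (fun x y => chi (g x) (g y)); first by move=> x y; exact: chi_sym.
exists (g \o f); split=> [x y j /f1/g1 //|j x y x' y'].
rewrite inE => /predU1P[->|]; last exact: f2.
by move=> /f1 ? /f1 ?; exact: g2.
Qed.

(** * From packings to minimal Ramsey graphs *)

Lemma proper_subgraph_size (T : finType) (F G : graph T) : proper_subgraph F G ->
  #|vertices F| + #|edges F| < #|vertices G| + #|edges G|.
Proof.
move=> [[sV sE] FG]; rewrite ltnNge; apply/negP => le.
have leV := subset_leq_card sV; have leE := subset_leq_card sE.
apply: FG; apply: graph_inj; apply/eqP; rewrite eqEcard ?sV ?sE /=.
  by rewrite -(leq_add2r #|edges G|) (leq_trans le) // leq_add2l.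
by rewrite -(leq_add2l #|vertices G|) (leq_trans le) // leq_add2r.
Qed.

Lemma subgraph_trans (T : finType) (E F G : graph T) :
  subgraph E F -> subgraph F G -> subgraph E G.
Proof. by move=> [? ?] [? ?]; split; apply: subset_trans; eassumption. Qed.

Lemma ramsey_minimal_subgraph (r : nat) (U T : finType) (H : graph U) (G : graph T) :
  ramsey r H G -> exists F, subgraph F G /\ ramsey_minimal r H F.
Proof.
have [n] := ubnP (#|vertices G| + #|edges G|); elim: n G => // n IH G le rG.
have [minG|] := pselect (forall F, proper_subgraph F G -> ~ ramsey r H F).
  by exists G; split.
move=> /existsNP[F /not_implyP[FG /contrapT rF]].
have [|E [EF mE]] := IH F _ rF; first exact: leq_trans (proper_subgraph_size FG) le.
by exists E; split=> //; apply: subgraph_trans EF FG.1.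
Qed.

Lemma min_degree_le (T : finType) (G : graph T) v :
  v \in vertices G -> min_degree G <= degree G v.
Proof.
rewrite /min_degree => vG; have := mem_index_enum v.
elim: (index_enum T) => // u s IH; rewrite inE big_cons => /predU1P[<-|/IH le].
  by rewrite vG geq_minl.
by case: ifP => // _; apply: leq_trans le; exact: geq_minr.
Qed.

(** A minimal Ramsey subgraph of [G] is one of the [F] in the hypothesis, and degrees in it are at
    most those in [G]. Its existence also shows that the minimum is attained. *)
Lemma is_s_exists_le (r : nat) (U T : finType) (H : graph U) (G : graph T) (n : nat) :
  ramsey r H G ->
  (forall F, subgraph F G -> ramsey r H F -> exists2 v, v \in vertices F & degree G v <= n) ->
  exists d, is_s r H d /\ d <= n.
Proof.
move=> /ramsey_minimal_subgraph[F [FG mF]] small.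
have [v vF dv] := small F FG mF.1.
have minF : minimal_ramsey_degree r H (min_degree F) by exists T, F.
have ex : exists d, `[< minimal_ramsey_degree r H d >] by exists (min_degree F); exact/asboolP.
exists (ex_minn ex); case: ex_minnP => d /asboolP dP dmin; split.
  by split=> // m /asboolP; exact: dmin.
apply: leq_trans (dmin _ (asboolT minF)) _; apply: leq_trans (min_degree_le vF) _.
apply: leq_trans dv; apply: subset_leq_card; apply/subsetP => e.
by rewrite !inE => /andP[/(subsetP FG.2)-> ->].
Qed.

Lemma edgeP (T : finType) (G : graph T) e : e \in edges G ->
  e \subset vertices G /\ #|e| = 2.
Proof. by case: G => V E p /= /(forall_inP p)/andP[? /eqP]. Qed.

Lemma exists_other_ord (k : nat) (a : 'I_k) : 1 < k -> exists b : 'I_k, b != a.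
Proof.
move=> k_gt1; have [a0|a0] := eqVneq (val a) 0.
  by exists (Ordinal k_gt1); rewrite -val_eqE a0.
by exists (Ordinal (ltnW k_gt1)); rewrite -val_eqE eq_sym.
Qed.

Lemma mono_clique_copy (T : finType) (G : graph T) (k : nat) (c : {set T} -> nat)
    (i : nat) (h : 'I_k -> T) : 1 < k ->
  (forall a b, a != b -> [set h a; h b] \in edges G /\ c [set h a; h b] = i) ->
  monochromatic_copy (complete k) G c.
Proof.
move=> k_gt1 hP; exists h, i; split=> [a b _ _|a _|e].
- apply: contra_eq => /hP[/edgeP[_]]; rewrite cards2; case: eqP => // ->.
- have [b ba] := exists_other_ord a k_gt1.
  have [/edgeP[/subsetP/(_ (h a)) + _] _] := hP _ _ ba; apply.
  by rewrite !inE eqxx orbT.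
- rewrite inE => /cards2P[a [b [ab ->]]].
  by rewrite imsetU1 imset_set1; exact: hP.
Qed.

Lemma mono_copy_clique (T : finType) (G : graph T) (k : nat) (c : {set T} -> nat) :
  monochromatic_copy (complete k) G c -> exists (i : nat) (h : 'I_k -> T),
    forall a b, a != b -> [set h a; h b] \in edges G /\ c [set h a; h b] = i.
Proof.
move=> [h [i [_ _ hP]]]; exists i, h => a b ab.
have := hP [set a; b]; rewrite imsetU1 imset_set1; apply.
by rewrite inE cards2 ab.
Qed.

(** * Gadgets that force distinct colours to stay distinct *)

Section Gadget.
Variables (k r : nat) (P : finType) (c : P -> P -> option 'I_r).
Hypotheses (k_gt2 : 2 < k) (c_sym : symmetric_fun c) (c_free : clique_free k c).

Definition gadget_vertex := (P + 'I_r * 'I_r * 'I_k)%type.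

(* The copy of [K_k] attached to [i != j] becomes monochromatic when the colours
   [i] and [j] are identified; its edge of colour [j] joins the vertices 0 and 1. *)
Definition gadget_color (u v : gadget_vertex) : option 'I_r :=
  match u, v with
  | inl x, inl y => c x y
  | inr (i, j, a), inr (i', j', b) =>
    if [&& i == i', j == j', i != j & a != b]
    then Some (if (a + b == 1)%N then j else i) else None
  | _, _ => None
  end.

Lemma gadget_color_sym : symmetric_fun gadget_color.
Proof.
move=> [x|[[i j] a]] [y|[[i' j'] b]] //=.
rewrite [i' == _]eq_sym [j' == _]eq_sym [b == _]eq_sym addnC.
by have [<-|] := eqVneq i i'; have [<-|] := eqVneq j j'.
Qed.

(** A clique outside [P] lies in a single attached copy and hence uses all its [k] vertices; there
    the edges 01 and 02 have the different colours [j] and [i]. *)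
Lemma gadget_clique_free : clique_free k gadget_color.
Proof.
move=> l h hcl.
have k_gt1 := ltnW k_gt2; have k_gt0 := ltnW k_gt1.
pose o0 := Ordinal k_gt0; pose o1 := Ordinal k_gt1; pose o2 := Ordinal k_gt2.
case E0: (h o0) => [x0|[[i j] a0]].
  have img a : exists x, h a == inl x.
    have [->|a0] := eqVneq a o0; first by exists x0; rewrite E0.
    by have := hcl a o0 a0; rewrite E0; case: (h a) => [x _|[[? ?] ?] //]; exists x.
  pose g a := xchoose (img a).
  have gP a : h a = inl (g a) by apply/eqP/(xchooseP (img a)).
  by apply: (c_free (j := l) (h := g)) => a b /hcl; rewrite !gP.
have img a : exists b, h a == inr (i, j, b).
  have [->|aN] := eqVneq a o0; first by exists a0; rewrite E0.
  have := hcl a o0 aN; rewrite E0; case: (h a) => // -[[i' j'] b] /=.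
  by case: ifP => // /and4P[/eqP-> /eqP-> _ _] _; exists b.
pose g a := xchoose (img a).
have gP a : h a = inr (i, j, g a) by apply/eqP/(xchooseP (img a)).
have gl a b : a != b -> [/\ i != j, g a != g b & (if (g a + g b == 1)%N then j else i) = l].
  by move=> /hcl; rewrite !gP /= !eqxx /=; case: ifP => // /andP[-> ->] [].
have g_inj : injective g by move=> a b; apply: contra_eq => /gl[].
have [g' _ gK] := injF_bij g_inj.
have g'N a b : a != b -> g' a != g' b.
  by apply: contra => /eqP e; rewrite -(gK a) e gK.
have [ij _] := gl _ _ (g'N o0 o1 isT); rewrite !gK /= => jl.
have [_ _] := gl _ _ (g'N o0 o2 isT); rewrite !gK /= => il.
by rewrite il jl eqxx in ij.
Qed.

End Gadget.

(** * The base graph with apex vertices *)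

Section Apex.
Variables (r : nat) (P T : finType) (c : T -> T -> option 'I_r).
Hypothesis c_irr : forall x, c x x = None.

(** There is one apex for each map [g] from [P] to the base, joined to the image of [g]: every copy
    of [P] has an apex, and no apex has degree above [#|P|]. *)
Definition apex_vertex := (T + {ffun P -> T})%type.

Definition apex_adj (u v : apex_vertex) : bool :=
  match u, v with
  | inl x, inl y => c x y != None
  | inr g, inl x => [exists p, x == g p]
  | _, _ => false
  end.

Definition apex_edges : {set {set apex_vertex}} :=
  [set [set z.1; z.2] | z in [set z : apex_vertex * apex_vertex | apex_adj z.1 z.2]].

Lemma apex_adj_irr u : ~~ apex_adj u u.
Proof. by case: u => //= x; rewrite c_irr eqxx. Qed.

Lemma apex_subproof :
  [forall e in apex_edges, (e \subset [set: apex_vertex]) && (#|e| == 2)].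
Proof.
apply/forall_inP => e /imsetP[[u v]]; rewrite inE /= => uv ->.
rewrite subsetT cards2; case: (eqVneq u v) uv => // ->.
by rewrite (negbTE (apex_adj_irr _)).
Qed.

Definition apex_graph : graph apex_vertex := Graph apex_subproof.

Lemma apex_edge u v : apex_adj u v -> [set u; v] \in edges apex_graph.
Proof. by move=> uv; apply/imsetP; exists (u, v); rewrite ?inE. Qed.

Lemma apex_degree g : degree apex_graph (inr g) <= #|P|.
Proof.
rewrite /degree; apply: leq_trans (leq_imset_card (fun p => [set inr g; inl (g p)]) P).
apply: subset_leq_card; apply/subsetP => e; rewrite inE => /andP[/imsetP[[u v]]].
rewrite inE /= => uv ->; rewrite !inE.
case: u v uv => [x|g'] [y|g''] //= /existsP[p /eqP->].
rewrite orbF => /eqP gg; have -> : g = g' by case: gg.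
exact: imset_f.
Qed.

Lemma set2_eq (S : finType) (x y u v : S) : [set x; y] = [set u; v] ->
  (x = u /\ y = v) \/ (x = v /\ y = u).
Proof.
move=> e.
have /set2P xuv : x \in [set u; v] by rewrite -e set21.
have /set2P yuv : y \in [set u; v] by rewrite -e set22.
have /set2P uxy : u \in [set x; y] by rewrite e set21.
have /set2P vxy : v \in [set x; y] by rewrite e set22.
by case: xuv yuv uxy vxy => [?|?] [?|?] [?|?] [?|?]; subst; auto.
Qed.

Lemma apex_edge_inl x y : symmetric_fun c ->
  [set (inl x : apex_vertex); inl y] \in edges apex_graph -> c x y != None.
Proof.
move=> c_sym /imsetP[[u v]]; rewrite inE /= => uv /set2_eq[[xu yv]|[xv yu]].
  by move: uv; rewrite -xu -yv.
by move: uv; rewrite -xv -yu /= c_sym.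
Qed.

Definition base_coloring (e : {set apex_vertex}) : nat :=
  if [pick z : T * T * 'I_r | (e == [set inl z.1.1; inl z.1.2]) && (c z.1.1 z.1.2 == Some z.2)]
  is Some z then z.2 else 0.

Lemma base_coloringE x y i : symmetric_fun c -> c x y = Some i ->
  base_coloring [set inl x; inl y] = i.
Proof.
move=> c_sym cxy; rewrite /base_coloring; case: pickP => [[[u v] j] /= |/(_ (x, y, i))].
  move=> /andP[/eqP/set2_eq uv /eqP cuv]; move: cxy.
  by case: uv => -[[->] [->]]; [rewrite cuv|rewrite c_sym cuv] => -[->].
by rewrite /= cxy !eqxx.
Qed.

(** The base coloured by [c] has no monochromatic [K_k]. The default 0 of [base_coloring] is a legal
    colour because [r] is positive. *)
Lemma ramsey_contains_apex (k : nat) (F : graph apex_vertex) :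
  1 < k -> symmetric_fun c -> clique_free k c -> 0 < r ->
  subgraph F apex_graph -> ramsey r (complete k) F -> exists g, inr g \in vertices F.
Proof.
move=> k_gt1 c_sym c_free r_gt0 FG rF; apply/existsP.
apply: contrapT => /negP; rewrite negb_exists => /forallP no_apex.
have /mono_copy_clique[i [h hP]] : monochromatic_copy (complete k) F base_coloring.
  by apply: rF => e _; rewrite /base_coloring; case: pickP => // -[[u v] j] _; case: j.
have img a : exists x, h a == inl x.
  have [b ab] := exists_other_ord a k_gt1; have [/edgeP[/subsetP/(_ (h a)) sub _] _] := hP _ _ ab.
  case E: (h a) => [x|g]; first by exists x.
  by have := no_apex g; rewrite -E sub // !inE eqxx orbT.
pose g a := xchoose (img a).
have gP a : h a = inl (g a) by apply/eqP/(xchooseP (img a)).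
have gcol a b : a != b -> exists2 j : 'I_r, c (g a) (g b) = Some j & j = i :> nat.
  move=> /hP[e ci]; move/(subsetP FG.2): e; rewrite !gP => /(apex_edge_inl c_sym).
  case E: (c (g a) (g b)) => [j|] // _; exists j => //.
  by rewrite -ci !gP (base_coloringE c_sym E).
have a0 : 'I_k := Ordinal (ltnW k_gt1).
have [b0 ab0] := exists_other_ord a0 k_gt1; have [j _ ji] := gcol _ _ ab0.
apply: (c_free j g) => a b /gcol[j' -> j'i]; congr Some.
by apply: val_inj; rewrite /= ji j'i.
Qed.

End Apex.

Lemma clique_free_irr (k : nat) (C T : Type) (c : T -> T -> option C) x :
  clique_free k c -> c x x = None.
Proof.
move=> c_free; case E: (c x x) => [j|] //.
by case: (c_free j (fun=> x)) => a b _.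
Qed.

(** In a uniform copy of [P] and its gadgets, colour [i] becomes [phi i]. If [phi] identifies two
    colours, their gadget is a monochromatic [K_k]. Otherwise [phi] is a bijection, and the colours
    of the edges from the apex to the copy of [P], pulled back by [phi], form a vertex colouring
    [xi]; the [K_(k-1)] that it yields is completed by the apex. *)
Theorem is_s_packing (k r : nat) (P : finType) (c : P -> P -> option 'I_r) :
  2 < k -> 1 < r -> symmetric_fun c -> clique_free k c ->
  (forall xi : P -> 'I_r, exists i (h : 'I_k.-1 -> P),
     (forall a, xi (h a) = i) /\ clique c i h) ->
  exists d, is_s r (complete k) d /\ d <= #|P|.
Proof.
move=> k_gt2 r_gt1 c_sym c_free pack.
have k_gt1 := ltnW k_gt2; have k_gt0 := ltnW k_gt1; have r_gt0 := ltnW r_gt1.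
have [T [c' [c'_sym c'_free HT]]] :=
  nesetril_rodl 'I_r k_gt2 (gadget_color_sym (k := k) c_sym) (gadget_clique_free k_gt2 c_free).
have c'_irr x := clique_free_irr x c'_free.
apply: (@is_s_exists_le _ _ _ _ (apex_graph P c'_irr)); last first.
  move=> F FG /(ramsey_contains_apex k_gt1 c'_sym c'_free r_gt0 FG)[g gF].
  by exists (inr g) => //; exact: apex_degree.
move=> col col_lt; set G := apex_graph P c'_irr.
pose V := apex_vertex P T.
have r_gt x y : c' x y != None -> col [set (inl x : V); inl y] < r.
  by move=> cxy; apply: col_lt; exact: apex_edge.
pose chi x y : 'I_r := insubd (Ordinal r_gt0) (col [set (inl x : V); inl y]).
have chiE x y j : c' x y = Some j -> col [set (inl x : V); inl y] = chi x y.
  by move=> cxy; rewrite /chi val_insubd r_gt ?cxy.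
have [|f [f_hom f_chi]] := HT chi; first by move=> x y; rewrite /chi setUC.
pose o0 := Ordinal k_gt0; pose o1 := Ordinal k_gt1; pose o2 := Ordinal k_gt2.
(* The gadget of [i] and [other i] has an edge 02 of colour [i]; thus every colour occurs and
   [phi i] can be read off. *)
pose other (i : 'I_r) : 'I_r := if i == Ordinal r_gt0 then Ordinal r_gt1 else Ordinal r_gt0.
have otherN i : i != other i by rewrite /other; have [->|] := eqVneq i (Ordinal r_gt0).
pose phi i := chi (f (inr (i, other i, o0))) (f (inr (i, other i, o2))).
have phiP i x y : gadget_color (k := k) c x y = Some i -> chi (f x) (f y) = phi i.
  by move=> cxy; apply: f_chi cxy _; rewrite /= !eqxx /= otherN.
have colP i x y : gadget_color (k := k) c x y = Some i ->
    [set (inl (f x) : V); inl (f y)] \in edges G /\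
    col [set (inl (f x) : V); inl (f y)] = phi i.
  move=> cxy; split; first by apply: apex_edge; rewrite /= (f_hom _ _ _ cxy).
  by rewrite (chiE _ _ _ (f_hom _ _ _ cxy)) (phiP _ _ _ cxy).
have [phi_inj|] := pselect (injective phi); last first.
  move=> /existsNP[i /existsNP[j /not_implyP[phi_ij /eqP ij]]].
  apply: (@mono_clique_copy _ _ _ _ (phi i) (fun a => inl (f (inr (i, j, a))))) => // a b ab.
  have cab : gadget_color c (inr (i, j, a)) (inr (i, j, b)) =
      Some (if (a + b == 1)%N then j else i) by rewrite /= !eqxx ij ab.
  by have [e1 ->] := colP _ _ _ cab; split=> //; case: ifP => // _; rewrite phi_ij.
have [psi _ psiK] := injF_bij phi_inj.
pose g := [ffun p => f (inl p)].
have apexE p : [set (inr g : V); inl (f (inl p))] \in edges G.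
  by apply: apex_edge; apply/existsP; exists p; rewrite ffunE.
pose theta p : 'I_r := insubd (Ordinal r_gt0) (col [set (inr g : V); inl (f (inl p))]).
have thetaE p : col [set (inr g : V); inl (f (inl p))] = theta p.
  by rewrite /theta val_insubd (col_lt _ (apexE p)).
have [i [h [hi hcl]]] := pack (fun p => psi (theta p)).
have {}hi a : theta (h a) = phi i by rewrite -(hi a) psiK.
(* Index 0 is the apex, the remaining indices are the vertices of the [K_(k-1)]. *)
pose h' (a : 'I_k.-1.+1) : V := oapp (fun b => inl (f (inl (h b)))) (inr g) (unlift ord0 a).
have kE : k.-1.+1 = k by rewrite prednK.
apply: (@mono_clique_copy _ _ _ _ (phi i) (fun a => h' (cast_ord (esym kE) a))) => // a b ab.
have {ab} : cast_ord (esym kE) a != cast_ord (esym kE) b.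
  by rewrite (inj_eq (@cast_ord_inj _ _ _)).
move: (cast_ord _ a) (cast_ord _ b) => {}a {}b; rewrite /h'.
case: unliftP => [a'|] ->; case: unliftP => [b'|] -> //= ab; rewrite ?eqxx // in ab *.
- apply: colP; apply: hcl; apply: contra ab => /eqP->; exact: eqxx.
- by rewrite setUC apexE thetaE hi.
- by rewrite apexE thetaE hi.
Qed.

(** * Weights of cliques in a linear space *)

Lemma card_le_cover_sum (T I : finType) (A : {set T}) (B : {set I}) (R : T -> I -> bool) :
  (forall x, x \in A -> exists2 i, i \in B & R x i) ->
  #|A| <= \sum_(i in B) #|[set x in A | R x i]|.
Proof.
move=> cov; rewrite -sum1_card.
apply: leq_trans (_ : \sum_(x in A) \sum_(i in B) R x i <= _).
  apply: leq_sum => x /cov[i iB Rxi]; rewrite (bigD1 i) //= Rxi; exact: leq_addr.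
rewrite exchange_big /=; apply: leq_sum => i _.
by rewrite -sum1_card big_mkcond [leqRHS]big_mkcond /=; apply: leq_sum => x _;
  rewrite inE; case: (x \in A); case: (R x i).
Qed.

Lemma card_le_cover (T I : finType) (A : {set T}) (B : {set I}) (R : T -> I -> bool) n :
  (forall x, x \in A -> exists2 i, i \in B & R x i) ->
  (forall i, i \in B -> #|[set x in A | R x i]| <= n) -> #|A| <= #|B| * n.
Proof.
move=> cov fib; apply: leq_trans (card_le_cover_sum cov) _.
by rewrite -sum_nat_const; apply: leq_sum.
Qed.

Lemma card_le1P (T : finType) (A : {set T}) :
  (forall x y, x \in A -> y \in A -> x = y) -> #|A| <= 1.
Proof. by move=> H; apply/card_le1_eqP => x y xA yA; exact: H. Qed.

Section LinearSpace.
Variables (P L : finType) (inc : P -> L -> bool) (cls : L -> nat) (d : nat) (i : nat).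

Definition pencil (p : P) := [set l | inc p l & cls l == i].

Definition compatible (T : {set P}) :=
  [forall p in T, forall p' in T, (p != p') ==> [exists l in pencil p, inc p' l]].

Definition joining (x : P) (T : {set P}) := [set l in pencil x | [exists p in T, inc p l]].

(** This is the number of small labels that a clique on [T] in class [i] requires. *)
Definition incidences (T : {set P}) := \sum_(p in T) #|joining p (T :\ p)|.

Definition extensions (T : {set P}) := [set x | (x \notin T) && compatible (x |: T)].

Hypothesis lin : forall p p' l l', p != p' ->
  inc p l -> inc p' l -> inc p l' -> inc p' l' -> l = l'.
Hypothesis pencil_card : forall p, #|pencil p| = d.

Lemma compatibleP (T : {set P}) p p' : compatible T -> p \in T -> p' \in T -> p != p' ->
  exists l, [/\ inc p l, inc p' l & cls l = i].
Proof.
move=> /forall_inP H pT p'T pp'; have /forall_inP/(_ _ p'T) := H _ pT.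
rewrite pp' => /exists_inP[l]; rewrite inE => /andP[? /eqP ?] ?; by exists l.
Qed.

Lemma extension_line T x p : x \in extensions T -> p \in T ->
  exists l, [/\ l \in pencil p, l \in joining x T, inc x l & inc p l].
Proof.
rewrite inE => /andP[xT comp] pT.
have [|||l [xl pl li]] := compatibleP (p := x) (p' := p) comp.
- exact: setU11.
- exact: setU1r.
- by apply: contra xT => /eqP->.
exists l; rewrite !inE xl pl li eqxx; split=> //=.
by apply/exists_inP; exists p.
Qed.

Lemma compatibleS (T T' : {set P}) : T \subset T' -> compatible T' -> compatible T.
Proof.
move=> /subsetP sub /forall_inP H; apply/forall_inP => p /sub/H/forall_inP H'.
by apply/forall_inP => p' /sub/H'.
Qed.

Lemma joiningS x (T T' : {set P}) : T \subset T' -> joining x T \subset joining x T'.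
Proof.
move=> /subsetP sub; apply/subsetP => l; rewrite !inE => /andP[-> /exists_inP[p /sub ? ?]].
by apply/exists_inP; exists p.
Qed.

Lemma incidences_setU1 x (T : {set P}) : x \notin T ->
  incidences T + #|joining x T| <= incidences (x |: T).
Proof.
move=> xT; rewrite /incidences big_setU1 //= addnC leq_add //.
  by apply/subset_leq_card/joiningS; rewrite setU1K.
by apply: leq_sum => p _; apply/subset_leq_card/joiningS/setSD/subsetUr.
Qed.

Lemma meet_card (A : {set P}) p p' :
  (forall x, x \in A -> exists l l',
     [/\ l \in pencil p, l' \in pencil p', l != l', inc x l & inc x l']) ->
  #|A| <= d * d.
Proof.
move=> H; rewrite -{1}(pencil_card p) -(pencil_card p') -cardsX -[leqRHS]muln1.
apply: (@card_le_cover _ _ _ _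
  (fun x l => [&& l.1 != l.2, inc x l.1 & inc x l.2])) => [x /H[l [l' [lp lp' ll' xl xl']]]|].
  by exists (l, l'); rewrite ?ll' ?xl //=; apply/setXP.
move=> [l l'] _; apply: card_le1P => x y.
rewrite !inE /= => /and4P[_ ll' xl xl'] /and4P[_ _ yl yl']; apply/eqP.
by apply: contraNT ll' => /lin/(_ xl yl xl' yl') ->.
Qed.

Section Extend.
Variables (p1 p2 p3 : P) (T : {set P}).
Hypothesis triple : forall l, ~~ [&& inc p1 l, inc p2 l & inc p3 l].
Hypotheses (T1 : p1 \in T) (T2 : p2 \in T) (T3 : p3 \in T).

(** The lines joining [x] to [p1], [p2] and [p3] cannot all coincide, because these points are not
    collinear. *)
Lemma extension_two_lines x : x \in extensions T ->
  (exists l l', [/\ l \in pencil p1, l' \in pencil p2, l != l', inc x l & inc x l'])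
  \/ (exists l l', [/\ l \in pencil p1, l' \in pencil p3, l != l', inc x l & inc x l']).
Proof.
move=> xT; have [l1 [l1p _ xl1 pl1]] := extension_line xT T1.
have [l2 [l2p _ xl2 pl2]] := extension_line xT T2.
have [l3 [l3p _ xl3 pl3]] := extension_line xT T3.
have [E|N] := eqVneq l1 l2; last by left; exists l1, l2.
right; exists l1, l3; split=> //; apply: contra (triple l1) => /eqP E'.
by rewrite pl1 {1}E pl2 E' pl3.
Qed.

Lemma extensions_card : #|extensions T| <= 2 * (d * d).
Proof.
pose A p := [set x | [exists l in pencil p1, exists l' in pencil p,
   [&& l != l', inc x l & inc x l']]].
have Acard p : #|A p| <= d * d.
  apply: (@meet_card _ p1 p) => x; rewrite inE => /exists_inP[l lp /exists_inP[l' lp']].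
  by move=> /and3P[? ? ?]; exists l, l'.
apply: leq_trans (_ : #|A p2 :|: A p3| <= _).
  apply/subset_leq_card/subsetP => x /extension_two_lines xP; rewrite !inE.
  by case: xP => -[l [l' [lp lp' ll' xl xl']]]; apply/orP; [left|right];
     apply/exists_inP; exists l => //; apply/exists_inP; exists l' => //; rewrite ll' xl.
by apply: leq_trans (leq_card_setU _ _) _; rewrite mul2n -addnn leq_add.
Qed.

Lemma joining_ge2 x : x \in extensions T -> 2 <= #|joining x T|.
Proof.
move=> xT; apply/card_gt1P.
have mem p l : p \in T -> l \in pencil p -> inc x l -> l \in joining x T.
  move=> pT; rewrite !inE => /andP[pl ->] ->; rewrite andbT.
  by apply/exists_inP; exists p.
case: (extension_two_lines xT) => -[l [l' [lp lp' ll' xl xl']]]; exists l, l'; split=> //.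
- exact: mem lp xl.
- exact: mem lp' xl'.
- exact: mem lp xl.
- exact: mem lp' xl'.
Qed.

Variable V : nat.
Hypothesis V_gt0 : 0 < V.
Hypothesis T_large : V.*2 <= #|T|.

Definition on_line l := [set p in T | inc p l].
Definition rich := [set l | (cls l == i) && (#|T| < V * #|on_line l|)].

(** An ordered pair of distinct points of [T] lies on at most one line, so no pair is counted
    twice. *)
Lemma pairs_on_lines : \sum_(l in rich) #|on_line l| * #|on_line l|.-1 <= #|T| * #|T|.
Proof.
apply: leq_trans (_ : \sum_(l in rich) \sum_(a in T) inc a l * #|on_line l :\ a| <= _).
  apply: leq_sum => l _; rewrite -sum_nat_const big_mkcond [leqRHS]big_mkcond /=.
  apply: leq_sum => a _; rewrite inE; case aT: (a \in T) => //=; case al: (inc a l) => //.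
  by rewrite mul1n (cardsD1 a (on_line l)) inE aT al.
rewrite exchange_big /= -sum_nat_const; apply: leq_sum => a aT.
apply: leq_trans (_ : \sum_(l in rich) \sum_(b in T) (inc a l && inc b l && (b != a)) <= _).
  apply: leq_sum => l _; case: (inc a l) => //; rewrite mul1n -sum1_card.
  rewrite big_mkcond [leqRHS]big_mkcond /=; apply: leq_sum => b _.
  by rewrite !inE; case: eqP; case: (b \in T); case: (inc b l).
rewrite exchange_big /= -sum1_card; apply: leq_sum => b bT.
have [->|ba] := eqVneq b a; first by rewrite big1 // => l _; rewrite andbF.
rewrite (eq_bigr (fun l => (inc a l && inc b l : nat))); last by move=> l _; rewrite andbT.
rewrite -big_mkcondr /= sum1dep_card; apply: card_le1P => l l'.
rewrite !inE => /andP[_ /andP[al bl]] /andP[_ /andP[al' bl']].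
exact: lin ba bl al bl' al'.
Qed.

(** A rich line has [h > #|T| / V >= 2] points of [T], hence at least [h^2 / 2 >= #|T|^2 / (2 V^2)]
    ordered pairs of them, out of at most [#|T|^2] pairs. *)
Lemma rich_card : #|rich| <= 2 * V ^ 2.
Proof.
have T_gt0 : 0 < #|T| by apply: leq_trans T_large; rewrite double_gt0.
rewrite -(leq_pmul2r (m := #|T| * #|T|)) ?muln_gt0 ?T_gt0 //.
apply: leq_trans (_ : 2 * V ^ 2 * \sum_(l in rich) #|on_line l| * #|on_line l|.-1 <= _);
  last by rewrite leq_mul2l pairs_on_lines orbT.
rewrite big_distrr /= -sum_nat_const; apply: leq_sum => l.
rewrite inE => /andP[_ lt].
have h2 : 2 <= #|on_line l|.
  rewrite leqNgt; apply/negP => le1.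
  have : V * #|on_line l| <= V * 1 by rewrite leq_mul2l -ltnS le1 orbT.
  by move: T_large lt; lia.
move: lt h2; move: #|on_line l| #|T| => h m lt h2.
have le : m * m <= (V * h) * (V * h) by rewrite leq_mul // ltnW.
have hh : h * h <= 2 * (h * h.-1) by case: h h2 {lt le} => [|h] //=; nia.
by apply: leq_trans le _; rewrite mulnACA mulnn [2 * V ^ 2]mulnC -mulnA leq_mul2l hh orbT.
Qed.

(** Fewer than [V] lines through [x] cover [T], so one of them carries more than the fraction [1/V]
    of it. *)
Lemma few_lines_rich x : x \in extensions T -> #|joining x T| < V ->
  exists2 l, l \in rich & inc x l.
Proof.
move=> xT few.
have T_gt0 : 0 < #|T| by apply: leq_trans T_large; rewrite double_gt0.
suff /exists_inP[l lj lr] : [exists l in joining x T, #|T| < V * #|on_line l|].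
  move: lj; rewrite !inE => /andP[/andP[xl li] _]; exists l => //.
  by rewrite inE li.
apply: contraLR few; rewrite negb_exists_in => /forall_inP H; rewrite -leqNgt.
rewrite -(leq_pmul2r T_gt0).
apply: leq_trans (_ : \sum_(l in joining x T) V * #|on_line l| <= _); last first.
  by rewrite -sum_nat_const; apply: leq_sum => l /H; rewrite -leqNgt.
rewrite -big_distrr leq_mul2l; apply/orP; right.
rewrite -sum1_card; apply: leq_trans (_ : \sum_(p in T) \sum_(l in joining x T) inc p l <= _).
  apply: leq_sum => p pT; have [l [_ lj _ pl]] := extension_line xT pT.
  by rewrite (bigD1 l) //= pl.
rewrite exchange_big /=; apply: leq_sum => l _.
rewrite -sum1_card big_mkcond [leqRHS]big_mkcond /=; apply: leq_sum => p _.
by rewrite inE; case: (p \in T); case: (inc p l).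
Qed.

(** A rich line [l] misses some [p] among the three points, and an extension [x] on [l] is the
    intersection of [l] with one of the [d] lines in the pencil of [p]. *)
Lemma few_lines_card : #|[set x in extensions T | #|joining x T| < V]| <= 2 * V ^ 2 * d.
Proof.
apply: leq_trans (_ : #|rich| * d <= _); last by rewrite leq_mul2r rich_card orbT.
apply: (@card_le_cover _ _ _ _ inc) => [x|l lr].
  by rewrite inE => /andP[]; exact: few_lines_rich.
have [p pT pl] : exists2 p, p \in T & ~~ inc p l.
  have := triple l; rewrite !negb_and => /or3P[?|?|?];
    [by exists p1|by exists p2|by exists p3].
rewrite -(pencil_card p) -[leqRHS]muln1; apply: (@card_le_cover _ _ _ _ inc) => [x|l'].
  rewrite !inE => /andP[/andP[xT _] xl].
  by have [|l' [lp _ xl' _]] := extension_line (T := T) (x := x) (p := p) _ pT;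
    [rewrite inE|exists l'].
rewrite inE => /andP[pl' _]; apply: card_le1P => x y; rewrite !inE.
move=> /andP[/andP[_ xl] xl'] /andP[/andP[_ yl] yl']; apply/eqP; apply: contraT => xy.
by have e := lin xy xl yl xl' yl'; rewrite e pl' in pl.
Qed.

End Extend.
End LinearSpace.

(** * The total weight of the clique sets containing a given triple *)

Section Weights.
Local Open Scope ring_scope.
Variables (P L : finType) (inc : P -> L -> bool) (cls : L -> nat) (d : nat) (i : nat).
Hypothesis lin : forall p p' l l', p != p' ->
  inc p l -> inc p' l -> inc p l' -> inc p' l' -> l = l'.
Hypothesis pencil_card : forall p, #|pencil inc cls i p| = d.
Variables (p1 p2 p3 : P).
Hypothesis triple : forall l, ~~ [&& inc p1 l, inc p2 l & inc p3 l].
Hypothesis triple3 : #|[set p1; p2; p3]| = 3.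
Variable Q : nat.
Hypothesis Q_gt0 : (0 < Q)%N.

Let rho : rat := Q%:R^-1.
Local Notation ext := (extensions inc cls i).
Local Notation join := (joining inc cls i).
Local Notation Inc := (incidences inc cls i).

Definition clique_sets (m : nat) :=
  [set T : {set P} | [&& #|T| == m, [set p1; p2; p3] \subset T & compatible inc cls i T]].

Definition total_weight (m : nat) : rat := \sum_(T in clique_sets m) (Q%:R^-1) ^+ Inc T.

Let rho_ge0 : 0 <= rho. Proof. by rewrite invr_ge0 ler0n. Qed.
Let rho_le1 : rho <= 1. Proof. by rewrite invf_le1 ?ltr0n // ler1n. Qed.

Lemma total_weight_ge0 m : 0 <= total_weight m.
Proof. by apply: sumr_ge0 => T _; apply: exprn_ge0. Qed.

(* A set of size [m.+1] arises from [m.+1 - 3] sets of size [m]: every point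
   except [p1], [p2], [p3] can be the one added last. *)
Lemma total_weight_step m (g : rat) :
  (forall T, T \in clique_sets m -> \sum_(x in ext T) rho ^+ #|join x T| <= g) ->
  total_weight m.+1 * (m - 2)%:R <= total_weight m * g.
Proof.
move=> step; set S0 := [set p1; p2; p3].
have -> : total_weight m.+1 * (m - 2)%:R =
    \sum_(T in clique_sets m.+1) \sum_(x in T :\: S0) rho ^+ Inc T.
  rewrite mulr_suml; apply: eq_bigr => T; rewrite inE => /and3P[/eqP Tm sub _].
  by rewrite sumr_const cardsD (setIidPr sub) Tm triple3 subSS mulr_natr.
have -> : \sum_(T in clique_sets m.+1) \sum_(x in T :\: S0) rho ^+ Inc T =
    \sum_x \sum_(T in clique_sets m.+1 | x \in T :\: S0) rho ^+ Inc T.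
  by rewrite (exchange_big_dep xpredT).
apply: le_trans (_ : \sum_x \sum_(T in clique_sets m | x \in ext T)
   rho ^+ Inc T * rho ^+ #|join x T| <= _); last first.
  rewrite (exchange_big_dep (mem (clique_sets m))) /=; last by move=> x T _ /andP[].
  rewrite mulr_suml; apply: ler_sum => T Tm.
  rewrite -mulr_sumr; apply: ler_wpM2l; first exact: exprn_ge0.
  rewrite (eq_bigl (mem (ext T))); first exact: step.
  by move=> x; rewrite Tm.
apply: ler_sum => x _.
rewrite (reindex_onto (fun T => x |: T) (fun T => T :\ x)) /=; last first.
  by move=> T /andP[_]; rewrite inE => /andP[_ xT]; rewrite setD1K.
rewrite [leLHS]big_mkcond [leRHS]big_mkcond /=; apply: ler_sum => T _.
have [|_] := boolP (_ && ((x |: T) :\ x == T)); last first.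
  by case: ifP => // _; rewrite mulr_ge0 ?exprn_ge0.
rewrite !inE => /andP[/andP[/and3P[/eqP Tm sub comp] /andP[xS _]] /eqP xT].
have {}xT : x \notin T by rewrite -xT !inE eqxx.
have -> : #|T| == m by move: Tm; rewrite cardsU1 xT add1n => -[->].
have -> : [set p1; p2; p3] \subset T.
  apply/subsetP => y yS; have := subsetP sub y yS; rewrite in_setU1 => /predU1P[yx|//].
  by move: yS; rewrite yx !inE (negbTE xS).
rewrite /= (compatibleS (subsetUr _ _) comp) xT comp /= -exprD.
apply: ler_wiXn2l => //; exact: incidences_setU1.
Qed.

Lemma clique_sets_step_le T m : T \in clique_sets m ->
  \sum_(x in ext T) rho ^+ #|join x T| <= (2 * (d * d))%:R.
Proof.
rewrite inE => /and3P[_ /subsetP sub _].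
have card : (#|ext T| <= 2 * (d * d))%N.
  by apply: (extensions_card lin pencil_card triple); apply: sub; rewrite !inE eqxx ?orbT.
apply: le_trans (_ : \sum_(x in ext T) 1 <= _).
  by apply: ler_sum => x _; apply: exprn_ile1.
by rewrite sumr_const ler_nat.
Qed.

(** Points on fewer than [V] joining lines are few and still lie on two of them; the others are
    counted crudely but weigh at most [rho ^+ V] each. *)
Lemma clique_sets_step_large V T m : (0 < V)%N -> (V.*2 <= m)%N -> T \in clique_sets m ->
  \sum_(x in ext T) rho ^+ #|join x T| <=
  (2 * V ^ 2 * d)%:R * rho ^+ 2 + (2 * (d * d))%:R * rho ^+ V.
Proof.
move=> V_gt0 Vm; rewrite inE => /and3P[/eqP Tm /subsetP sub _].
have T1 : p1 \in T by apply: sub; rewrite !inE eqxx ?orbT.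
have T2 : p2 \in T by apply: sub; rewrite !inE eqxx ?orbT.
have T3 : p3 \in T by apply: sub; rewrite !inE eqxx ?orbT.
have card := extensions_card lin pencil_card triple T1 T2 T3.
rewrite -Tm in Vm.
have few := few_lines_card lin pencil_card triple T1 T2 T3 V_gt0 Vm.
rewrite (bigID (fun x => #|join x T| < V)%N) /=; apply: lerD.
  apply: le_trans (_ : \sum_(x in ext T | (#|join x T| < V)%N) rho ^+ 2 <= _).
    apply: ler_sum => x /andP[xT _]; apply: ler_wiXn2l => //.
    exact: (joining_ge2 triple).
  rewrite sumr_const -[leLHS]mulr_natl; apply: ler_wpM2r; first exact: exprn_ge0.
  by rewrite ler_nat; apply: leq_trans few; apply: subset_leq_card;
     apply/subsetP => x; rewrite [in X in _ -> X]inE.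
apply: le_trans (_ : \sum_(x in ext T | ~~ (#|join x T| < V)%N) rho ^+ V <= _).
  by apply: ler_sum => x /andP[xT]; rewrite -leqNgt; exact: ler_wiXn2l.
rewrite sumr_const -[leLHS]mulr_natl; apply: ler_wpM2r; first exact: exprn_ge0.
by rewrite ler_nat; apply: leq_trans card; apply: subset_leq_card;
     apply/subsetP => x /andP[].
Qed.

Lemma total_weight3 : total_weight 3 <= 1.
Proof.
apply: le_trans (_ : \sum_(T in [set [set p1; p2; p3]]) rho ^+ Inc T <= _); last first.
  by rewrite big_set1; apply: exprn_ile1.
rewrite [leLHS]big_mkcond [leRHS]big_mkcond /=; apply: ler_sum => T _.
rewrite !inE; case: ifP => [/and3P[/eqP T3 sub _]|_]; last first.
  by case: ifP => // _; exact: exprn_ge0.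
suff -> : T == [set p1; p2; p3] by [].
by rewrite eq_sym eqEcard sub T3 triple3.
Qed.

Lemma total_weight_small n : total_weight (n + 3) * n`!%:R <= (2 * (d * d))%:R ^+ n.
Proof.
elim: n => [|n IH]; first by rewrite mulr1 total_weight3.
have := total_weight_step (m := n + 3) (fun T => @clique_sets_step_le T _).
rewrite (_ : (n + 3 - 2)%N = n.+1); last by lia.
move=> le; rewrite addSn factS natrM mulrA exprSr.
apply: le_trans (_ : total_weight (n + 3) * (2 * (d * d))%:R * n`!%:R <= _).
  exact: ler_wpM2r.
by rewrite mulrAC; apply: ler_wpM2r.
Qed.

(** The crude bound serves for the first [n] added points, until the set has at least [V.*2] points;
    the refined bound serves for the other [m]. *)
Lemma total_weight_large V n m : (0 < V)%N -> (V.*2 <= n + 3)%N ->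
  total_weight (n + m + 3) * (n + m)`!%:R <= (2 * (d * d))%:R ^+ n *
    ((2 * V ^ 2 * d)%:R * rho ^+ 2 + (2 * (d * d))%:R * rho ^+ V) ^+ m.
Proof.
move=> V_gt0 Vn; set g := _ + _.
have g_ge0 : 0 <= g by rewrite addr_ge0 // mulr_ge0 ?exprn_ge0.
elim: m => [|m IH]; first by rewrite addn0 mulr1 total_weight_small.
have Vm : (V.*2 <= n + m + 3)%N by lia.
have := total_weight_step (fun T => @clique_sets_step_large V T _ V_gt0 Vm).
rewrite (_ : (n + m + 3 - 2)%N = (n + m).+1); last by lia.
move=> le; rewrite (addnS n m) (addSn (n + m) 3) factS natrM mulrA exprSr.
apply: le_trans (_ : total_weight (n + m + 3) * g * (n + m)`!%:R <= _).
  exact: ler_wpM2r.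
by rewrite mulrAC mulrA; apply: ler_wpM2r.
Qed.

End Weights.

(** * Random labels *)

Lemma card_ffun_in (X Y : finType) (F : X -> {set Y}) :
  #|[set g : {ffun X -> Y} | [forall x, g x \in F x]]| = \prod_x #|F x|.
Proof.
rewrite (eq_card (B := family F)); last by move=> g; rewrite inE; apply/forallP/familyP.
by rewrite card_family foldrE big_map enumT.
Qed.

Section Labels.
Variables (P L : finType) (inc : P -> L -> bool) (cls : L -> nat) (d r k K Q : nat).

Local Notation labeling := {ffun L -> {ffun P -> 'I_K}}.

Definition label_adj (lam : labeling) (i : nat) (p p' : P) :=
  [exists l, [&& inc p l, inc p' l, cls l == i, lam l p < k.-1, lam l p' < k.-1
               & lam l p != lam l p']].

Definition label_color (lam : labeling) (p p' : P) : option 'I_r :=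
  [pick i : 'I_r | label_adj lam i p p'].

Definition misses (W : {set P}) (g : {ffun P -> 'I_K}) :=
  [exists j : 'I_k.-1, [forall p in W, g p != j :> nat]].

Definition hit_set (xi : {ffun P -> 'I_r}) l := [set p | inc p l && (xi p == cls l :> nat)].

(** A line that misses no small label has points with all [k-1] small labels among those coloured by
    its class, and these form the desired [K_(k-1)]. Labels are given to non-incident pairs as well,
    which makes the labelings a full product. *)
Definition bad_coloring : {set labeling} :=
  [set lam : labeling | [exists xi, [forall l, misses (hit_set xi l) (lam l)]]].

Definition bad_clique : {set labeling} :=
  [set lam : labeling | [exists i : 'I_r, [exists h : {ffun 'I_k -> P},
     [forall a, [forall b, (a != b) ==> label_adj lam i (h a) (h b)]]]]].

Hypotheses (k_gt2 : 2 < k) (Q_gt0 : 0 < Q) (K_def : K = k * Q).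
Hypothesis lin : forall p p' l l', p != p' ->
  inc p l -> inc p' l -> inc p l' -> inc p' l' -> l = l'.
Hypothesis pencil_card : forall i p, i < r -> #|pencil inc cls i p| = d.

Let kK : k.-1 <= K.
Proof. by rewrite K_def (leq_trans (leq_pred k)) // leq_pmulr. Qed.

(** Union bound over the missed label: a fixed label is avoided on [W] with probability
    [(1 - 1/K)^#|W|]. Here and below, probabilities are counts with denominators cleared. *)
Lemma misses_card W :
  #|[set g | misses W g]| * K ^ #|W| <= k.-1 * (K.-1 ^ #|W| * K ^ #|P|).
Proof.
set M := K.-1 ^ #|W| * _.
have K_gt0 : 0 < K by rewrite K_def muln_gt0 Q_gt0 (ltnW (ltnW k_gt2)).
have one (j : 'I_k.-1) :
    #|[set g : {ffun P -> 'I_K} | [forall p in W, g p != j :> nat]]| * K ^ #|W| = M.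
  pose F p : {set 'I_K} := if p \in W then [set~ widen_ord kK j] else setT.
  rewrite (eq_card (B := [set g : {ffun P -> 'I_K} | [forall x, g x \in F x]])); last first.
    move=> g; rewrite !inE; apply: eq_forallb => p; rewrite /F.
    by case: ifP => _; rewrite ?inE.
  have eW : #|W| = \sum_(p in W) 1 by rewrite sum1_card.
  have eP : #|P| = \sum_(p : P) 1 by rewrite sum1_card.
  rewrite card_ffun_in /M !eW eP !expn_sum big_mkcond /= [X in _ = X * _]big_mkcond /=.
  rewrite [X in _ * X = _]big_mkcond -!big_split /=; apply: eq_bigr => p _; rewrite /F.
  by case: ifP => _; rewrite ?cardsC1 ?cardsT card_ord // !expn1 mul1n muln1.
apply: leq_trans (leq_mul (card_le_cover_sum (A := [set g | misses W g]) (B := [set: 'I_k.-1])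
  (R := fun (g : {ffun P -> 'I_K}) j => [forall p in W, g p != j :> nat]) _) (leqnn _)) _.
  by move=> g; rewrite inE => /existsP[j gj]; exists j.
rewrite big_distrl /= -[X in X * M]card_ord -cardsT -sum_nat_const; apply: leq_sum => j _.
rewrite -(one j) leq_mul2r; apply/orP; right.
by apply/subset_leq_card/subsetP => g; rewrite !inE => /andP[].
Qed.

Lemma bad_coloring_card : #|bad_coloring| * K ^ (d * #|P|) <=
  r ^ #|P| * (k.-1 ^ #|L| * K.-1 ^ (d * #|P|) * K ^ (#|P| * #|L|)).
Proof.
have K_gt0 : 0 < K by rewrite K_def muln_gt0 Q_gt0 (ltnW (ltnW k_gt2)).
set M := k.-1 ^ _ * _ * _.
have one (xi : {ffun P -> 'I_r}) :
    #|[set lam : labeling | [forall l, misses (hit_set xi l) (lam l)]]| * K ^ (d * #|P|) <= M.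
  rewrite (eq_card (B := [set lam : labeling |
     [forall l, lam l \in [set g | misses (hit_set xi l) g]]])); last first.
    by move=> g; rewrite !inE; apply: eq_forallb => l; rewrite inE.
  (* Each point lies on exactly [d] lines of the class named by its own colour. *)
  have hits : \sum_l #|hit_set xi l| = d * #|P|.
    transitivity (\sum_l \sum_p (inc p l && (cls l == xi p :> nat) : nat)).
      apply: eq_bigr => l _; rewrite -sum1_card big_mkcond /=; apply: eq_bigr => p _.
      by rewrite inE eq_sym; case: (_ && _).
    rewrite exchange_big /= mulnC -sum_nat_const; apply: eq_bigr => p _.
    rewrite -(pencil_card p (ltn_ord (xi p))) -sum1_card [RHS]big_mkcond /=.
    by apply: eq_bigr => l _; rewrite inE; case: (_ && _).
  rewrite card_ffun_in /M -hits !expn_sum -big_split /= expnM.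
  rewrite -[k.-1 ^ #|L|]prod_nat_const -[(K ^ #|P|) ^ #|L|]prod_nat_const -!big_split /=.
  by apply: leq_prod => l _; rewrite -mulnA; exact: misses_card.
have D_gt0 : 0 < K ^ (d * #|P|) by rewrite expn_gt0 K_gt0.
have cF : #|[set: {ffun P -> 'I_r}]| = r ^ #|P| by rewrite cardsT card_ffun card_ord.
apply: leq_trans (_ : r ^ #|P| * (M %/ K ^ (d * #|P|)) * K ^ (d * #|P|) <= _); last first.
  by rewrite -mulnA leq_mul2l leq_divM orbT.
rewrite leq_mul2r -cF; apply/orP; right.
apply: (@card_le_cover _ _ _ _ (fun (lam : labeling) xi =>
  [forall l, misses (hit_set xi l) (lam l)])).
  by move=> lam; rewrite inE => /existsP[xi ?]; exists xi.
move=> xi _; rewrite leq_divRL //; apply: leq_trans (one xi); rewrite leq_mul2r.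
by rewrite subset_leq_card ?orbT //; apply/subsetP => lam; rewrite !inE => /andP[].
Qed.

Definition good_labels (i : nat) (T : {set P}) : {set labeling} :=
  [set lam : labeling | [forall l, [forall p,
     (p \in T) && (l \in joining inc cls i p (T :\ p)) ==> (lam l p < k.-1)]]].

(** Each required entry is confined to [k-1] of the [k * Q] labels, a fraction of at most [1/Q]. *)
Lemma good_labels_card i T :
  #|good_labels i T| * Q ^ incidences inc cls i T <= K ^ (#|P| * #|L|).
Proof.
pose c l p := (p \in T) && (l \in joining inc cls i p (T :\ p)).
pose F l p : {set 'I_K} := if c l p then [set j : 'I_K | j < k.-1] else setT.
have lowK : #|[set j : 'I_K | j < k.-1]| = k.-1.
  have winj : injective (widen_ord kK) by move=> j j' /(congr1 val)/= ?; exact: val_inj.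
  rewrite -[RHS]card_ord -[RHS]cardsT -(card_imset _ winj).
  apply: eq_card => j; rewrite inE; apply/idP/imsetP => [jk|[j' _ ->]]; last exact: (ltn_ord j').
  by exists (Ordinal jk) => //; exact: val_inj.
rewrite (eq_card (B := [set lam : labeling |
   [forall l, lam l \in [set g : {ffun P -> 'I_K} | [forall p, g p \in F l p]]]])); last first.
  move=> lam; rewrite !inE; apply: eq_forallb => l; rewrite inE; apply: eq_forallb => p.
  by rewrite /F /c; case: ifP => _; rewrite ?inE.
have -> : incidences inc cls i T = \sum_l \sum_p (c l p : nat).
  rewrite exchange_big /= /incidences big_mkcond /=; apply: eq_bigr => p _.
  rewrite /c; case: (p \in T) => /=; last by rewrite big1.
  by rewrite -sum1_card big_mkcond /=; apply: eq_bigr => l _; case: (_ \in _).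
rewrite card_ffun_in expnM !expn_sum -prod_nat_const -big_split /=.
apply: leq_prod => l _; rewrite card_ffun_in expn_sum -prod_nat_const -big_split /=.
apply: leq_prod => p _; rewrite /F; case: (c l p); last by rewrite cardsT card_ord muln1.
by rewrite lowK expn1 K_def leq_mul2r leq_pred orbT.
Qed.

Lemma bad_clique_triple lam : lam \in bad_clique ->
  exists (i : 'I_r) p1 p2 p3 T,
    [/\ forall l, ~~ [&& inc p1 l, inc p2 l & inc p3 l], #|[set p1; p2; p3]| = 3,
        T \in clique_sets inc cls i p1 p2 p3 k & lam \in good_labels i T].
Proof.
rewrite inE => /existsP[i /existsP[h /forallP H]].
have {}H a b : a != b -> label_adj lam i (h a) (h b).
  by move=> ab; have /forallP/(_ b)/implyP := H a; exact.
have h_inj : injective h.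
  move=> a b; apply: contra_eq => /H/existsP[l /and5P[_ _ _ _ /andP[_ N]]].
  by apply: contra N => /eqP->.
have k_gt1 := ltnW k_gt2; have k_gt0 := ltnW k_gt1.
pose o0 := Ordinal k_gt0; pose o1 := Ordinal k_gt1.
have /existsP[l0 /and5P[l00 l01 _ _ _]] := H o0 o1 isT.
have h01 : h o0 != h o1 by rewrite (inj_eq h_inj).
have [a la] : exists a, ~~ inc (h a) l0.
  (* If all [k] points were on [l0], they would need distinct labels below [k-1]. *)
  apply/existsP; rewrite -negb_forall; apply/negP => /forallP all0.
  have on0 a b : a != b -> lam l0 (h a) < k.-1 /\ lam l0 (h a) != lam l0 (h b).
    move=> ab; have /existsP[l /and5P[al bl _ a1 /andP[_ N]]] := H a b ab.
    by rewrite (lin (p := h a) (p' := h b) (l := l0) (l' := l)) ?(inj_eq h_inj).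
  have low a : lam l0 (h a) < k.-1.
    by have [b ba] := exists_other_ord a k_gt1; have [] := on0 a b _; rewrite // eq_sym.
  have inj : injective (fun a => Ordinal (low a)).
    move=> a b; apply: contra_eq => /on0[_ N].
    by apply: contra N => /eqP/(congr1 val)/= e; apply/eqP/val_inj.
  by have := leq_card _ inj; rewrite !card_ord -ltnS prednK // ltnn.
have h0a : h o0 != h a by apply: contra la => /eqP<-.
have h1a : h o1 != h a by apply: contra la => /eqP<-.
have tri l : ~~ [&& inc (h o0) l, inc (h o1) l & inc (h a) l].
  by apply: contra la => /and3P[l0' l1' al]; rewrite (lin h01 l00 l01 l0' l1').
exists i, (h o0), (h o1), (h a), [set h b | b : 'I_k]; split=> //.
- by rewrite -setUA cardsU1 cards2 !inE (negbTE h01) (negbTE h0a) h1a.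
- rewrite inE card_imset // card_ord eqxx /=; apply/andP; split.
    by apply/subsetP => p; rewrite !inE => /orP[/orP[]|] /eqP->; exact: imset_f.
  apply/forall_inP => _ /imsetP[b _ ->]; apply/forall_inP => _ /imsetP[b' _ ->].
  rewrite (inj_eq h_inj); apply/implyP => /H/existsP[l /and5P[bl b'l li _ _]].
  by apply/exists_inP; exists l; rewrite // inE bl.
- rewrite inE; apply/forallP => l; apply/forallP => p; apply/implyP.
  move=> /andP[/imsetP[b _ ->]]; rewrite !inE => /andP[/andP[bl li] /exists_inP[q]].
  rewrite !inE => /andP[qb /imsetP[b' _ eq]] ql; rewrite eq in qb ql.
  have bb' : b != b' by apply: contra qb => /eqP->.
  have /existsP[l' /and5P[bl' b'l' _ lb _]] := H b b' bb'.
  by rewrite (lin (p := h b) (p' := h b') (l := l) (l' := l')) // (inj_eq h_inj).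
Qed.

(** Union bound over the colour, the non-collinear triple and the clique sets containing it, each of
    which has probability at most its weight. *)
Lemma bad_clique_card (N : nat) :
  (forall i p1 p2 p3, i < r -> (forall l, ~~ [&& inc p1 l, inc p2 l & inc p3 l]) ->
     #|[set p1; p2; p3]| = 3 ->
     (total_weight inc cls i p1 p2 p3 Q k * N%:R <= 1)%R) ->
  #|bad_clique| * N <= r * #|P| ^ 3 * K ^ (#|P| * #|L|).
Proof.
case: N => [|N]; first by rewrite muln0.
move=> wt; set M := K ^ _.
pose B := [set z : 'I_r * (P * P * P) |
  [forall l, ~~ [&& inc z.2.1.1 l, inc z.2.1.2 l & inc z.2.2 l]]
  && (#|[set z.2.1.1; z.2.1.2; z.2.2]| == 3)].
pose cl (z : 'I_r * (P * P * P)) := clique_sets inc cls z.1 z.2.1.1 z.2.1.2 z.2.2 k.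
have /leq_trans-> // : #|bad_clique| * N.+1 <= #|B| * (M %/ N.+1) * N.+1.
  rewrite leq_mul2r; apply/orP; right.
  apply: (card_le_cover (R := fun lam z => [exists T in cl z, lam \in good_labels z.1 T])).
    move=> lam /bad_clique_triple[i [p1 [p2 [p3 [T [tri c3 cT gT]]]]]].
    exists (i, (p1, p2, p3)); first by rewrite inE /= c3 eqxx andbT; apply/forallP.
    by apply/exists_inP; exists T.
  move=> [i [[p1 p2] p3]]; rewrite inE /= => /andP[/forallP tri /eqP c3].
  rewrite leq_divRL //.
  set A := [set _ in _ | _].
  have le1 : #|A| <= \sum_(T in cl (i, (p1, p2, p3))) #|good_labels i T|.
    apply: leq_trans (card_le_cover_sum (B := cl (i, (p1, p2, p3)))
      (R := fun lam T => lam \in good_labels i T) _) _.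
      by move=> lam; rewrite inE => /andP[_ /exists_inP[T ? ?]]; exists T.
    apply: leq_sum => T _; apply/subset_leq_card/subsetP => lam.
    by rewrite inE => /andP[].
  rewrite -(ler_nat rat) natrM.
  apply: le_trans (_ : M%:R * (total_weight inc cls i p1 p2 p3 Q k * N.+1%:R) <= _)%R; last first.
    by rewrite -[leRHS]mulr1 ler_wpM2l // wt.
  rewrite mulrA; apply: ler_wpM2r => //.
  apply: le_trans (_ : (\sum_(T in cl (i, (p1, p2, p3))) #|good_labels i T|)%:R <= _)%R.
    by rewrite ler_nat.
  rewrite natr_sum mulr_sumr; apply: ler_sum => T _.
  rewrite exprVn ler_pdivlMr ?exprn_gt0 ?ltr0n // -natrX -natrM ler_nat.
  exact: good_labels_card.
rewrite -mulnA; apply: leq_mul; last exact: leq_divM.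
apply: leq_trans (max_card _) _; rewrite !card_prod card_ord.
by rewrite !expnS expn0 muln1 !mulnA.
Qed.

(** At most a quarter of the labelings lie in [bad_coloring] and at most half in [bad_clique], so
    some labeling avoids both. *)
Lemma label_packing :
  0 < #|P| -> #|L| <= #|P| ->
  4 * (r * k.-1 * K.-1 ^ d) <= K ^ d ->
  (forall i p1 p2 p3, i < r -> (forall l, ~~ [&& inc p1 l, inc p2 l & inc p3 l]) ->
     #|[set p1; p2; p3]| = 3 ->
     (total_weight inc cls i p1 p2 p3 Q k * (2 * (r * #|P| ^ 3))%N%:R <= 1)%R) ->
  exists c : P -> P -> option 'I_r,
    [/\ symmetric_fun c, clique_free k c &
     forall xi : P -> 'I_r, exists i (h : 'I_k.-1 -> P),
       (forall a, xi (h a) = i) /\ clique c i h].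
Proof.
move=> P_gt0 LP num wt.
have K_gt0 : 0 < K by rewrite K_def muln_gt0 Q_gt0 (ltnW (ltnW k_gt2)).
set M := K ^ (#|P| * #|L|).
have M_gt0 : 0 < M by rewrite expn_gt0 K_gt0.
have [->|r_gt0] := posnP r.
  exists (fun _ _ => None); split=> // [[]//|xi].
  by have /card_gt0P[p _] := P_gt0; case: (xi p).
have small1 : 4 * #|bad_coloring| <= M.
  have D_gt0 : 0 < K ^ (d * #|P|) by rewrite expn_gt0 K_gt0.
  rewrite -(leq_pmul2r D_gt0) -mulnA.
  apply: leq_trans (leq_mul (leqnn 4) bad_coloring_card) _.
  rewrite [M * _]mulnC !mulnA leq_mul2r; apply/orP; right.
  apply: leq_trans (_ : (4 * (r * k.-1 * K.-1 ^ d)) ^ #|P| <= _); last first.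
    by rewrite expnM leq_exp2r.
  rewrite !expnMn -expnM !mulnA leq_mul2r; apply/orP; right.
  apply: leq_mul; last by rewrite leq_pexp2l // -ltnS prednK // ltnW // ltnW.
  rewrite leq_mul2r; apply/orP; right.
  by case: (#|P|) P_gt0 => // n _; rewrite expnS leq_pmulr // expn_gt0.
have small2 : 2 * #|bad_clique| <= M.
  have rP : 0 < r * #|P| ^ 3 by rewrite muln_gt0 r_gt0 expn_gt0 P_gt0.
  rewrite -(leq_pmul2l rP); apply: leq_trans (bad_clique_card wt).
  by rewrite mulnA [r * _ ^ 3 * 2]mulnC mulnC.
have [lam lamN] : exists lam, lam \notin bad_coloring :|: bad_clique.
  apply/existsP; rewrite -negb_forall; apply/negP => /forallP all.
  have : #|{: labeling}| <= #|bad_coloring :|: bad_clique|.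
    by apply/subset_leq_card/subsetP => lam _; exact: all.
  rewrite !card_ffun !card_ord -expnM -/M.
  by have := (leq_card_setU bad_coloring bad_clique).1; lia.
move: lamN; rewrite inE negb_or => /andP[col cliq].
have adj_sym i p p' : label_adj lam i p p' = label_adj lam i p' p.
  by apply: eq_existsb => l; rewrite [_ == lam l p]eq_sym; case: (inc p l); case: (inc p' l);
     case: (cls l == i); case: (lam l p < _); case: (lam l p' < _).
have adj_uniq i j p p' : label_adj lam i p p' -> label_adj lam j p p' -> i = j.
  move=> /existsP[l /and5P[pl p'l /eqP<- _ /andP[_ N]]] /existsP[l' /and5P[pl' p'l' /eqP<- _ _]].
  congr cls; apply: (lin (p := p) (p' := p')) => //; by apply: contra N => /eqP->.
have colorP (i : 'I_r) p p' : reflect (label_color lam p p' = Some i) (label_adj lam i p p').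
  rewrite /label_color; case: pickP => [j ji|none]; last by rewrite none; constructor.
  apply: (iffP idP) => [ii|[<-] //]; congr Some; exact/val_inj/(adj_uniq _ _ _ _ ji ii).
exists (label_color lam); split.
- by move=> p p'; apply: eq_pick => i; exact: adj_sym.
- move=> i h hcl; case/negP: cliq; rewrite inE; apply/existsP; exists i.
  apply/existsP; exists [ffun a => h a]; apply/forallP => a; apply/forallP => b.
  by rewrite !ffunE; apply/implyP => /hcl/colorP.
- move=> xi; move: col; rewrite inE negb_exists => /forallP/(_ [ffun p => xi p]).
  rewrite negb_forall => /existsP[l]; rewrite negb_exists => /forallP miss.
  have hit (j : 'I_k.-1) : exists p, [&& inc p l, xi p == cls l :> nat & lam l p == j :> nat].
    have := miss j; rewrite negb_forall_in => /exists_inP[p].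
    rewrite inE ffunE negbK => /andP[pl px] pj; by exists p; rewrite pl px.
  pose h j := xchoose (hit j).
  have hP j : [/\ inc (h j) l, xi (h j) = cls l :> nat & lam l (h j) = j :> nat].
    by have /and3P[? /eqP ? /eqP ?] := xchooseP (hit j).
  have k1 : 0 < k.-1 by move: k_gt2; case: (k) => [|[]].
  exists (xi (h (Ordinal k1))), h; split=> [a|a b ab].
    by apply: val_inj => /=; have [_ -> _] := hP a; have [_ -> _] := hP (Ordinal k1).
  apply/colorP/existsP; exists l.
  have [al _ aj] := hP a; have [bl _ bj] := hP b; have [_ -> _] := hP (Ordinal k1).
  rewrite al bl eqxx aj bj !ltn_ord /=.
  by apply: contra ab => /eqP/(congr1 val) /=; rewrite aj bj => /val_inj ->.
Qed.

End Labels.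

(** * The affine plane *)

Section AffinePlane.
Local Open Scope ring_scope.
Variables (F : finFieldType) (d : nat).

(** The line [l] has slope [l.1] and intercept [l.2]; vertical lines are left out, so each slope
    gives one line through each point. *)
Definition on_affine_line (p l : F * F) := p.2 == l.1 * p.1 + l.2.

(** The slopes are numbered and cut into consecutive blocks of [d]. *)
Definition slope_class (l : F * F) : nat := (enum_rank l.1 %/ d)%N.

Lemma affine_linear p p' l l' : p != p' -> on_affine_line p l -> on_affine_line p' l ->
  on_affine_line p l' -> on_affine_line p' l' -> l = l'.
Proof.
case: p p' l l' => [x y] [x' y'] [a b] [a' b']; rewrite /on_affine_line /=.
move=> N /eqP e1 /eqP e2 /eqP e3 /eqP e4.
have xx : x - x' != 0.
  rewrite subr_eq0; apply: contra N => /eqP xx; move: e1; rewrite xx -e2 => ->.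
  exact: eqxx.
have aa : a = a'.
  apply: (mulIf xx); apply/eqP; rewrite -subr_eq0.
  have -> : a * (x - x') - a' * (x - x') =
    (a * x + b) - (a' * x + b') - ((a * x' + b) - (a' * x' + b')) by ring.
  by rewrite -e1 -e3 -e2 -e4 !subrr.
congr (_, _) => //; apply: (addrI (a * x)).
by rewrite -e1 e3 aa.
Qed.

Lemma rank_fiber_card i : (0 < d)%N -> (i * d + d <= #|F|)%N ->
  #|[set a : F | (enum_rank a %/ d)%N == i]| = d.
Proof.
move=> d_gt0 le; have lt (j : 'I_d) : (i * d + j < #|F|)%N.
  by apply: leq_trans le; rewrite ltn_add2l.
pose g j := enum_val (Ordinal (lt j)) : F.
have g_inj : injective g.
  by move=> j j' /enum_val_inj/(congr1 val)/= /addnI; exact: val_inj.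
rewrite -[RHS]card_ord -[RHS]cardsT -(card_imset _ g_inj); apply: eq_card => a.
rewrite inE; apply/eqP/imsetP => [ai|[j _ ->]]; last first.
  by rewrite enum_valK /= divnMDl // divn_small // addn0.
exists (Ordinal (ltn_pmod (enum_rank a) d_gt0)) => //.
apply: enum_rank_inj; rewrite /g enum_valK; apply: val_inj => /=.
by rewrite -ai -divn_eq.
Qed.

Lemma affine_pencil_card i p : (0 < d)%N -> (i * d + d <= #|F|)%N ->
  #|pencil on_affine_line slope_class i p| = d.
Proof.
move=> d_gt0 le; rewrite -[RHS](rank_fiber_card d_gt0 le).
have inj : injective (fun a : F => (a, p.2 - a * p.1)) by move=> a b [].
rewrite -(card_imset _ inj); apply: eq_card => -[a b]; rewrite inE /on_affine_line /=.
apply/andP/imsetP => [[/eqP pE ai]|[a']].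
  by exists a; rewrite ?inE // pE addrC addKr.
by rewrite inE => ai [-> ->]; rewrite subrKC.
Qed.

End AffinePlane.

Lemma affine_packing (k r d K Q m : nat) :
  2 < k -> 0 < Q -> K = k * Q -> 0 < m -> 0 < d -> r * d <= 2 ^ m ->
  4 * (r * k.-1 * K.-1 ^ d) <= K ^ d ->
  (forall (P L : finType) (inc : P -> L -> bool) (cls : L -> nat) i p1 p2 p3,
     (forall p p' l l', p != p' ->
        inc p l -> inc p' l -> inc p l' -> inc p' l' -> l = l') ->
     (forall p, #|pencil inc cls i p| = d) ->
     (forall l, ~~ [&& inc p1 l, inc p2 l & inc p3 l]) ->
     #|[set p1; p2; p3]| = 3 ->
     (total_weight inc cls i p1 p2 p3 Q k * (2 * (r * (2 ^ m) ^ 6))%N%:R <= 1)%R) ->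
  exists (P : finType) (c : P -> P -> option 'I_r),
    [/\ #|P| = (2 ^ m) ^ 2, symmetric_fun c, clique_free k c &
     forall xi : P -> 'I_r, exists i (h : 'I_k.-1 -> P),
       (forall a, xi (h a) = i) /\ clique c i h].
Proof.
move=> k_gt2 Q_gt0 KE m_gt0 d_gt0 rd num wt.
have [F _ FE] := PrimePowerField (isT : prime 2) m_gt0.
have PE : #|{: F * F}| = (2 ^ m) ^ 2 by rewrite card_prod FE mulnn.
have pen i (p : F * F) : i < r -> #|pencil (@on_affine_line F) (@slope_class F d) i p| = d.
  move=> ir; apply: affine_pencil_card => //; rewrite FE; apply: leq_trans rd.
  by rewrite addnC -mulSn leq_mul2r ir orbT.
have [||||c [c_sym c_free c_col]] := label_packing (P := (F * F)%type) (L := (F * F)%type)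
  k_gt2 Q_gt0 KE (@affine_linear F) pen.
- by rewrite PE !expn_gt0.
- by [].
- exact: num.
- move=> i p1 p2 p3 ir tri c3; rewrite PE -expnM.
  exact: (wt _ _ _ _ _ _ _ _ (@affine_linear F) (fun p => pen i p ir) tri c3).
by exists (F * F)%type, c.
Qed.

(** * Choice of the parameters *)

Lemma bernoulli_nat n m : n ^ m * (n + m) <= n.+1 ^ m * n.
Proof.
elim: m => [|m IH]; first by rewrite !expn0 addn0.
rewrite !expnS; apply: leq_trans (_ : n.+1 * (n ^ m * (n + m)) <= _); last first.
  by rewrite -mulnA leq_mul2l IH orbT.
by rewrite -!mulnA [n.+1 * _]mulnCA mulnCA leq_mul2l; apply/orP; right; nia.
Qed.

(** Bernoulli's inequality for [(1 + 1/n)^(n+1)] with [n = K - 1]. *)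
Lemma half_power K : 0 < K -> 2 * K.-1 ^ K <= K ^ K.
Proof.
case: K => [//|n _] /=; have [->|n_gt0] := posnP n; first by rewrite exp0n.
rewrite -(leq_pmul2r n_gt0); apply: leq_trans (bernoulli_nat n n.+1).
by rewrite [2 * _]mulnC -mulnA leq_mul2l; apply/orP; right; lia.
Qed.

(** Between the two sides lies the falling factorial of [2n] of length [n], which is [n!] times a
    binomial coefficient that is at most [2^(2n)]. *)
Lemma expn_self_fact n : n ^ n <= 4 ^ n * n`!.
Proof.
apply: leq_trans (_ : (2 * n) ^_ n <= _).
  rewrite ffact_prod -[X in _ ^ X]card_ord -prod_nat_const; apply: leq_prod => i _.
  by have := ltn_ord i; lia.
rewrite -bin_ffact leq_mul2r; apply/orP; right.
have := expnDn 1 1 (2 * n); rewrite (_ : 4 ^ n = 2 ^ (2 * n)); last by rewrite expnM.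
rewrite addn1 => ->; have lt : n < (2 * n).+1 by lia.
rewrite (bigD1 (Ordinal lt)) //= !exp1n !muln1; exact: leq_addr.
Qed.

Lemma expn_fact_sub3 k : 2 < k -> k ^ (k - 3) <= 4 ^ k * (k - 3)`!.
Proof.
move=> k_gt2; have k3 : 0 < k ^ 3 by rewrite expn_gt0; lia.
rewrite -(leq_pmul2r k3) -expnD subnK //; apply: leq_trans (expn_self_fact k) _.
rewrite -mulnA leq_mul2l; apply/orP; right.
have -> : k`! = k * (k.-1 * (k.-2 * (k - 3)`!)).
  by case: k k_gt2 {k3} => [|[|[|n]]] // _; rewrite !factS subSS subSS subSS subn0.
have le : k * k.-1 * k.-2 <= k ^ 3.
  by rewrite !expnS expn0 muln1 -mulnA !leq_mul // ?leq_pred // (leq_trans (leq_pred _)) ?leq_pred.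
by rewrite [leqRHS]mulnC; apply: leq_trans (leq_mul le (leqnn _)); rewrite !mulnA.
Qed.

Section WeightBound.
Local Open Scope ring_scope.
Variables (P L : finType) (inc : P -> L -> bool) (cls : L -> nat) (i : nat) (p1 p2 p3 : P).
Variables (k r V l Y d Q q : nat).
Hypothesis lin : forall p p' l l', p != p' ->
  inc p l -> inc p' l -> inc p l' -> inc p' l' -> l = l'.
Hypothesis pencil_card : forall p, #|pencil inc cls i p| = d.
Hypothesis triple : forall l, ~~ [&& inc p1 l, inc p2 l & inc p3 l].
Hypothesis triple3 : #|[set p1; p2; p3]| = 3.
Hypotheses (V_gt2 : (2 < V)%N) (l_gt0 : (0 < l)%N) (Y_gt0 : (0 < Y)%N).
Hypotheses (Q_def : Q = (64 * V ^ 2 * l ^ 2 * Y)%N) (d_def : d = (k * Q * l)%N).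
Hypothesis Q_large : (k * l <= Q ^ (V - 3))%N.
Hypothesis k_large : (4 * V <= k)%N.

Let step := (2 * V ^ 2 * d)%:R * (Q%:R^-1) ^+ 2 + (2 * (d * d))%:R * (Q%:R^-1) ^+ V : rat.

Let V_gt0 : (0 < V)%N. Proof. exact: ltn_trans V_gt2. Qed.

Let Q_gt0 : (0 < Q)%N.
Proof. by rewrite Q_def !muln_gt0 ?expn_gt0 V_gt0 l_gt0 Y_gt0. Qed.

(** The term with [V] lines is at most [2kl/Q] by [Q_large], the other one equals [2V^2kl/Q]; the
    constant 64 in [Q] makes their sum at most [k/(16lY)]. *)
Let step_bound : step * (16 * l * Y)%:R <= k%:R.
Proof.
have QR : (0 : rat) < Q%:R by rewrite ltr0n.
have tail : (2 * (d * d))%:R * (Q%:R^-1) ^+ V <= (2 * k * l)%:R * Q%:R^-1 :> rat.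
  rewrite exprVn -ler_pdivrMr ?invr_gt0 // invrK mulrAC ler_pdivrMr ?exprn_gt0 //.
  rewrite -natrX -!natrM ler_nat d_def.
  have -> : (Q ^ V = Q ^ (V - 3) * (Q * Q * Q))%N.
    by rewrite -[in LHS](subnK V_gt2) expnD !expnS expn0 muln1 !mulnA.
  have := leq_mul (leqnn (2 * k * l * (Q * Q * Q))) Q_large; nia.
have head : (2 * V ^ 2 * d)%:R * (Q%:R^-1) ^+ 2 = (2 * V ^ 2 * k * l)%:R * Q%:R^-1 :> rat.
  rewrite d_def expr2 !natrM; field; exact: lt0r_neq0.
have bound : step * Q%:R <= (4 * V ^ 2 * k * l)%:R.
  apply: le_trans (_ : (2 * V ^ 2 * k * l + 2 * k * l)%:R <= _); last first.
    rewrite ler_nat; have : (1 <= V ^ 2)%N by rewrite expn_gt0 V_gt0.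
    by nia.
  rewrite natrD -ler_pdivlMr // mulrDl /step head lerD2l.
  exact: tail.
have c_gt0 : (0 : rat) < (4 * V ^ 2 * l)%:R.
  by rewrite ltr0n !muln_gt0 ?expn_gt0 l_gt0 V_gt0.
rewrite -(ler_pM2r c_gt0) -mulrA -!natrM.
rewrite (_ : (16 * l * Y * (4 * V ^ 2 * l) = Q)%N); last by rewrite Q_def; lia.
by rewrite (_ : (k * (4 * V ^ 2 * l) = 4 * V ^ 2 * k * l)%N) //; lia.
Qed.

(** The power of [k] is cancelled by [(k-3)!] up to a factor [4^k], which [16^(k-2V)] absorbs
    because [k >= 4V]. *)
Lemma total_weight_power :
  total_weight inc cls i p1 p2 p3 Q k * (l * Y)%:R ^+ (k - V.*2)
    <= (2 * (d * d))%:R ^+ (V.*2 - 3).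
Proof.
set W := total_weight _ _ _ _ _ _ _ _; set A := _%:R ^+ (V.*2 - 3).
have A_ge0 : 0 <= A :> rat by apply: exprn_ge0.
have k_gt2 : (2 < k)%N by lia.
have Vn : (V.*2 <= V.*2 - 3 + 3)%N by lia.
have := total_weight_large lin pencil_card triple triple3 Q_gt0 (k - V.*2) V_gt0 Vn.
rewrite (_ : (V.*2 - 3 + (k - V.*2) = k - 3)%N); last by lia.
rewrite !subnK //; try lia.
rewrite -/W -/A -/step => le.
have step_ge0 : 0 <= step by rewrite addr_ge0 // mulr_ge0 ?exprn_ge0 ?invr_ge0.
have F_gt0 : (0 : rat) < (k - 3)`!%:R by rewrite ltr0n fact_gt0.
have le2 : W * (k - 3)`!%:R * (16 * l * Y)%:R ^+ (k - V.*2) <= A * k%:R ^+ (k - V.*2).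
  apply: le_trans (ler_wpM2r (exprn_ge0 _ (ler0n _ _)) le) _.
  rewrite -mulrA -exprMn; apply: ler_wpM2l => //.
  by apply: lerXn2r; rewrite ?nnegrE ?ler0n ?mulr_ge0.
have le3 : W * (16 * l * Y)%:R ^+ (k - V.*2) <= A * (4 ^ k)%:R.
  rewrite -(ler_pM2r F_gt0) mulrAC; apply: le_trans le2 _; rewrite -mulrA.
  apply: ler_wpM2l => //; rewrite -natrX -natrM ler_nat.
  apply: leq_trans (expn_fact_sub3 k_gt2); apply: leq_pexp2l; lia.
have c_gt0 : (0 : rat) < (4 ^ k)%:R by rewrite ltr0n expn_gt0.
rewrite -(ler_pM2r c_gt0); apply: le_trans le3; rewrite -mulrA.
apply: ler_wpM2l; first exact: total_weight_ge0.
rewrite -!natrX -natrM ler_nat -(mulnA 16) (expnMn 16) mulnC leq_mul2r.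
apply/orP; right; rewrite (_ : 16%N = 4 ^ 2)%N // -expnM leq_pexp2l //; lia.
Qed.

(** Since [q <= 2rd], the factor [2rq^6] is at most [16r^7(2d^2)^3], which raises the exponent
    [2V-3] of [2d^2] to [2V]. *)
Lemma total_weight_bound : (0 < r)%N -> (q <= 2 * (r * d))%N ->
  (16 * r ^ 7 * (2 * (d * d)) ^ V.*2 <= (l * Y) ^ (k - V.*2))%N ->
  total_weight inc cls i p1 p2 p3 Q k * (2 * (r * q ^ 6))%N%:R <= 1.
Proof.
move=> r_gt0 q_le num; set W := total_weight _ _ _ _ _ _ _ _.
have W_ge0 : 0 <= W by exact: total_weight_ge0.
have d_gt0 : (0 < d)%N by rewrite d_def !muln_gt0 Q_gt0 l_gt0; lia.
have A_gt0 : (0 < (2 * (d * d)) ^ (V.*2 - 3))%N by rewrite expn_gt0 !muln_gt0 d_gt0.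
rewrite -(ler_pM2r (x := ((2 * (d * d)) ^ (V.*2 - 3))%N%:R)) ?ltr0n // mul1r natrX.
apply: le_trans total_weight_power; rewrite -/W -mulrA; apply: ler_wpM2l => //.
rewrite -!natrX -natrM ler_nat; apply: leq_trans num.
have -> : ((2 * (d * d)) ^ V.*2 = (2 * (d * d)) ^ (V.*2 - 3) * (2 * (d * d)) ^ 3)%N.
  by rewrite -expnD subnK //; lia.
apply: leq_trans (_ : 2 * (r * (2 * (r * d)) ^ 6) * (2 * (d * d)) ^ (V.*2 - 3) <= _)%N.
  by rewrite !leq_mul2r !leq_mul2l leq_exp2r // q_le !orbT.
by apply: eq_leq; rewrite mulnCA mulnC [RHS]mulnC -!mulnA; ring.
Qed.

End WeightBound.

(** For [t] the binary logarithm of [k] and [V = t + 5] this gives [(15 + 6t) * 4V <= k]; the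
    threshold [2^13] for [k] comes from here. *)
Lemma quadratic_le_exp2 t : 13 <= t -> (15 + 6 * t) * (4 * (t + 5)) <= 2 ^ t.
Proof.
move=> t13; rewrite -(subnK t13); elim: (t - 13) => [|n IH]; first by rewrite [2 ^ _]expnS; vm_compute.
rewrite addSn expnS; move: IH; move: (2 ^ _) => X; nia.
Qed.

Lemma packing_exists (k r : nat) : 2 ^ 13 <= k -> 2 <= r ->
  exists (P : finType) (c : P -> P -> option 'I_r) (Y : nat),
  [/\ symmetric_fun c, clique_free k c,
     forall xi : P -> 'I_r, exists i (h : 'I_k.-1 -> P),
       (forall a, xi (h a) = i) /\ clique c i h,
     (Y.-1 ^ k./2 < 16 * r ^ 7) /\ 1 < Y &
     #|P| <= 2 ^ 14 * r ^ 2 * k ^ 2 * (trunc_log 2 k + 5) ^ 4 *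
             (trunc_log 2 (r * k) + 3) ^ 6 * Y ^ 2].
Proof.
move=> k_large r_ge2.
(* As [V - 3 = t + 2], the power [Q^(V-3)] is at least [kl]. As [2^l >= 4rk] and [d = Kl], the
   condition on vertex colourings follows from [half_power]. *)
set t := trunc_log 2 k; pose V := t + 5; pose l := trunc_log 2 (r * k) + 3.
rewrite -/V -/l.
have t13 : 13 <= t by rewrite -(trunc_expnK (p := 2) 13) //; exact: leq_trunc_log.
have /andP[kt kt1] : 2 ^ t <= k < 2 ^ t.+1.
  by apply: trunc_log_bounds => //; apply: leq_trans k_large; rewrite expn_gt0.
have quad := leq_trans (quadratic_le_exp2 t13) kt.
have kV : 28 * V <= k by rewrite /V; nia.
have h_gt0 : 0 < k./2 by lia.
have exY : exists Y, 16 * r ^ 7 <= Y ^ k./2.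
  by exists (16 * r ^ 7); rewrite -{1}[16 * _]expn1; apply: leq_pexp2l; lia.
(* [Y] pays for the factor [16r^7]; its minimality is what keeps it of order [r^(14/k)]. *)
pose Y := ex_minn exY.
have [Y_pow Y_min] : 16 * r ^ 7 <= Y ^ k./2 /\ forall n, 16 * r ^ 7 <= n ^ k./2 -> Y <= n.
  by rewrite /Y; case: ex_minnP.
have r7 : 1 < 16 * r ^ 7.
  by have : 0 < r ^ 7 by [rewrite expn_gt0 (ltnW r_ge2)]; lia.
have Y_gt1 : 1 < Y.
  rewrite ltnNge; apply/negP => Y1.
  have : Y ^ k./2 <= 1 ^ k./2 by rewrite leq_exp2r.
  by rewrite exp1n => le; move: (leq_trans Y_pow le); lia.
have Y_pred : Y.-1 ^ k./2 < 16 * r ^ 7.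
  by rewrite ltnNge; apply/negP => /Y_min; lia.
pose Q := 64 * V ^ 2 * l ^ 2 * Y; pose K := k * Q; pose d := K * l.
have V_gt2 : 2 < V by rewrite /V; lia.
have l_gt1 : 1 < l by rewrite /l; lia.
have l_gt0 : 0 < l by apply: ltnW.
have Q_gt0 : 0 < Q by rewrite /Q !muln_gt0 ?expn_gt0 l_gt0; lia.
have k_gt0 : 0 < k by lia.
have K_gt0 : 0 < K by rewrite muln_gt0 k_gt0.
have d_gt0 : 0 < d by rewrite muln_gt0 K_gt0.
have r_gt0 : 0 < r by apply: ltnW.
have rd_gt0 : 0 < r * d by rewrite muln_gt0 r_gt0.
(* The field order [2^m] exceeds [rd] and is at most [2rd]. *)
pose m := (trunc_log 2 (r * d)).+1.
have /andP[m_le rd_le] : 2 ^ m.-1 <= r * d < 2 ^ m by exact: trunc_log_bounds.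
have q_le : 2 ^ m <= 2 * (r * d) by rewrite [2 ^ m]expnS leq_mul2l.
have /andP[_ rk_lt] : 2 ^ trunc_log 2 (r * k) <= r * k < 2 ^ (trunc_log 2 (r * k)).+1.
  by apply: trunc_log_bounds; rewrite // muln_gt0 r_gt0.
have [||||||P [c [Pcard c_sym c_free c_col]]] :=
    @affine_packing k r d K Q m _ Q_gt0 erefl.
- by lia.
- by [].
- exact: d_gt0.
- exact: ltnW.
- rewrite (expnM K.-1 K l) (expnM K K l); apply: leq_trans (_ : 2 ^ l * (K.-1 ^ K) ^ l <= _); last first.
    by rewrite -expnMn leq_exp2r // half_power.
  rewrite mulnA leq_mul2r; apply/orP; right.
  have -> : 2 ^ l = 4 * 2 ^ (trunc_log 2 (r * k)).+1.
    by rewrite /l addnC expnD [in RHS]expnS mulnA.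
  rewrite leq_mul2l /=; apply: leq_trans (ltnW rk_lt).
  by rewrite leq_mul2l leq_pred orbT.
- move=> P L inc cls i p1 p2 p3 lin pen tri c3.
  apply: (total_weight_bound (V := V) (l := l) (Y := Y) (d := d)) => //.
  + exact: ltnW.
  + have -> : V - 3 = t.+2 by rewrite /V; lia.
    have lQ : l <= Q by rewrite /Q -mulnA mulnC [l ^ 2]expnS -!mulnA leq_pmulr // !muln_gt0 ?expn_gt0 l_gt0; lia.
    rewrite expnS mulnC leq_mul //; apply: leq_trans (ltnW kt1) _.
    rewrite leq_exp2r //; apply: leq_trans lQ; exact: l_gt1.
  + by clear -kV; lia.
  (* The factors of [(lY)^(k-2V)] are shared out: [l^(k-14V)] pays for the constants and the powers
     of [k] and [V], [Y^(k-6V)] for [16r^7], while [l^(12V)] and [Y^(4V)] match the same factors of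
     [(2d^2)^(2V)]. *)
  + rewrite /d /K /Q.
    have -> : 2 * (k * (64 * V ^ 2 * l ^ 2 * Y) * l * (k * (64 * V ^ 2 * l ^ 2 * Y) * l)) =
       2 ^ 13 * k ^ 2 * V ^ 4 * l ^ 6 * Y ^ 2 by rewrite (_ : 2 ^ 13 = 2 * (64 * 64)) //; clear; ring.
    rewrite [(_ * Y ^ 2) ^ _]expnMn [(_ * l ^ 6) ^ _]expnMn -!expnM.
    set Z := (_ * V ^ 4) ^ _.
    have Z_le : Z <= l ^ (k - 14 * V).
      apply: leq_trans (_ : 2 ^ (k - 14 * V) <= _); last by by rewrite leq_exp2r //; clear -kV V_gt2; lia.
      apply: leq_trans (_ : (2 ^ (15 + 6 * t)) ^ V.*2 <= _).
        rewrite leq_exp2r; last by clear -V_gt2; lia.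
        have Vt : V <= 2 ^ t.
          by have := quadratic_le_exp2 t13; rewrite /V; clear; nia.
        have k2 : k ^ 2 <= 2 ^ (2 * t.+1) by rewrite mulnC expnM leq_exp2r // ltnW.
        have V4 : V ^ 4 <= 2 ^ (4 * t) by rewrite mulnC expnM leq_exp2r.
        rewrite (_ : 15 + 6 * t = 13 + 2 * t.+1 + 4 * t); last by clear; lia.
        rewrite (expnD 2 (13 + _)) (expnD 2 13).
        exact: leq_mul (leq_mul (leqnn _) k2) V4.
      rewrite -expnM leq_pexp2l //; move: quad; rewrite /V; clear; lia.
    have Y_le : 16 * r ^ 7 <= Y ^ (k - 6 * V).
      apply: leq_trans Y_pow _; rewrite leq_pexp2l ?(ltnW Y_gt1) //; clear -kV h_gt0; lia.
    rewrite expnMn.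
    have -> : l ^ (k - V.*2) = l ^ (k - 14 * V) * l ^ (6 * V.*2).
      by rewrite -expnD; congr expn; clear -kV; lia.
    have -> : Y ^ (k - V.*2) = Y ^ (k - 6 * V) * Y ^ (2 * V.*2).
      by rewrite -expnD; congr expn; clear -kV; lia.
    rewrite -(mulnA Z) (mulnA (16 * _)) (mulnC _ Z) [leqRHS]mulnACA.
    exact: leq_mul (leq_mul Z_le Y_le) (leqnn _).
exists P, c, Y; split=> //; rewrite Pcard.
(* The constant [2^14] is the square of [2 * 64], from [2rd] and the 64 in [Q]. *)
apply: leq_trans (_ : (2 * (r * d)) ^ 2 <= _); first by rewrite leq_exp2r.
rewrite /d /K /Q (_ : 2 ^ 14 = 4 * (64 * 64)) //; apply: eq_leq; clear; ring.
Qed.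

(** * Estimates with natural logarithms and real powers *)

Local Open Scope ring_scope.

(** The inequality [ln (1 + x) <= x] at [x = -1/2]. *)
Lemma ln2_ge_half (R : realType) : 2^-1 <= ln (2 : R).
Proof.
have := @le_ln1Dx R (- 2^-1); rewrite (_ : 1 - 2^-1 = 2^-1 :> R); last by lra.
by rewrite lnV ?posrE; [move=> /(_ _); lra|lra].
Qed.

Lemma trunc_log_le_ln (R : realType) (n : nat) : (0 < n)%N ->
  (trunc_log 2 n)%:R <= 2 * ln (n%:R : R).
Proof.
move=> n_gt0; have le : ln ((2 ^ trunc_log 2 n)%:R : R) <= ln n%:R.
  by rewrite ler_ln ?posrE ?ltr0n ?expn_gt0 // ler_nat trunc_logP.
rewrite natrX lnXn // -[ln _ *+ _]mulr_natl in le.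
have := ler_wpM2l (ler0n R (trunc_log 2 n)) (@ln2_ge_half R); lra.
Qed.

Lemma ln_natr_ge1 (R : realType) (n : nat) : (4 <= n)%N -> 1 <= ln (n%:R : R).
Proof.
move=> n4; apply: le_trans (_ : ln (2 ^+ 2 : R) <= _).
  by rewrite lnXn //; have := @ln2_ge_half R; lra.
by rewrite ler_ln ?posrE -?natrX ?ler_nat // ltr0n; apply: leq_trans n4.
Qed.

Lemma ln_le_self (R : realType) (x : R) : 0 < x -> ln x <= x.
Proof.
move=> x0; have := @le_ln1Dx R (x - 1); rewrite (_ : 1 + (x - 1) = x) => [le|]; last by lra.
by apply: le_trans (le _) _; lra.
Qed.

(** [Y <= 2(Y-1)], and with [h = k./2] the square of [Y-1] is at most [(16r^7)^(2/h)]. The exponent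
    30 arises from [14/h <= 30/k], which holds from [k = 15] on; the constant is [4 * 16^2]. *)
Lemma root_bound (R : realType) (r k Y : nat) : (0 < r)%N -> (15 <= k)%N -> (1 < Y)%N ->
  (Y.-1 ^ k./2 < 16 * r ^ 7)%N ->
  (Y ^ 2)%:R <= 2 ^+ 10 * (r%:R : R) `^ (30 / k%:R).
Proof.
move=> r_gt0 k15 Y_gt1 lt; set h := k./2 in lt.
have h_gt0 : (0 < h)%N by rewrite /h; lia.
have hR : (0 : R) < h%:R by rewrite ltr0n.
have kR : (0 : R) < k%:R by rewrite ltr0n; lia.
have rR : (1 : R) <= r%:R by rewrite ler1n.
have eq : (Y.-1%:R : R) ^+ 2 = (Y.-1%:R ^+ h) `^ (2 / h%:R).
  rewrite -!powR_mulrn // -powRrM; congr (_ `^ _); field; exact: lt0r_neq0.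
have le1 : (Y.-1%:R : R) ^+ 2 <= (16 * r%:R ^+ 7) `^ (2 / h%:R).
  rewrite eq; apply: ge0_ler_powR.
  - by rewrite divr_ge0.
  - by rewrite nnegrE exprn_ge0.
  - by rewrite nnegrE mulr_ge0 ?exprn_ge0.
  - by rewrite -!natrX -natrM ler_nat ltnW.
have le2 : (16 * r%:R ^+ 7) `^ (2 / h%:R) <= 256 * (r%:R : R) `^ (30 / k%:R).
  rewrite powRM ?exprn_ge0 //; apply: ler_pM; rewrite ?powR_ge0 //.
    apply: le_trans (_ : 16 `^ 2%:R <= _); last by rewrite powR_mulrn //; lra.
    apply: ler_powR; first by lra.
    by rewrite ler_pdivrMr // ler_peMr // ler1n.
  rewrite -powR_mulrn // -powRrM; apply: ler_powR => //.
  rewrite mulrA ler_pdivrMr // mulrAC ler_pdivlMr // -!natrM ler_nat.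
  by rewrite /h; lia.
apply: le_trans (_ : (4 * Y.-1 ^ 2)%:R <= _).
  by rewrite ler_nat -[4%N]/(2 ^ 2)%N -expnMn leq_exp2r //; lia.
rewrite natrM natrX; have := le_trans le1 le2; rewrite (_ : 2 ^+ 10 = 4 * 256); last by lra.
by rewrite -mulrA ler_pM2l.
Qed.

Theorem theorem1 (R : realType) :
  exists k0 r0 : nat, forall k r : nat,
    (k0 <= k)%N -> (r0 <= r)%N ->
    k%:R <= r%:R * ln (r%:R : R) ^+ 2 ->
    exists d : nat, is_s r (complete k) d /\
      d%:R <= 2 ^+ 400 * k%:R ^+ 2 * r%:R `^ (2 + 30 / k%:R)
              * ln (r%:R : R) ^+ 20 * ln (k%:R : R) ^+ 20.
Proof.
exists (2 ^ 13)%N, 4%N => k r k_large r4 kr.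
have k13 : (13 <= trunc_log 2 k)%N.
  by rewrite -(trunc_expnK (p := 2) 13) //; exact: leq_trunc_log.
have k15 : (15 <= k)%N by apply: leq_trans k_large.
have r_gt0 : (0 < r)%N by apply: leq_trans r4.
have k_gt0 : (0 < k)%N by apply: leq_trans k15.
have [P [c [Y [c_sym c_free c_col [Yh Y_gt1] Pcard]]]] :=
  packing_exists k_large (ltnW (ltnW r4)).
have [d [ds dP]] := is_s_packing (ltn_trans (isT : (2 < 14)%N) k15) (ltnW (ltnW r4)) c_sym c_free c_col.
exists d; split=> //.
have rR : (0 : R) < r%:R by rewrite ltr0n.
have kR : (0 : R) < k%:R by rewrite ltr0n.
set x := ln (r%:R : R); set y := ln (k%:R : R).
have x1 : 1 <= x by exact: ln_natr_ge1.
have y1 : 1 <= y by apply: ln_natr_ge1; apply: leq_trans k15.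
have x_gt0 : 0 < x by apply: lt_le_trans x1.
have y_gt0 : 0 < y by apply: lt_le_trans y1.
(* From [k <= r ln^2 r <= r^3]. *)
have yx : y <= 3 * x.
  rewrite mulr_natl -lnXn // ler_ln ?posrE ?exprn_gt0 //; apply: le_trans kr _.
  rewrite [leRHS]exprS; apply: ler_wpM2l; first exact: ltW.
  by apply: lerXn2r; rewrite ?nnegrE ?ler0n ?(ltW x_gt0) //; exact: ln_le_self.
(* Since [y >= 1], the fourth power is at most the twentieth; the sixth power of [x] is treated
   likewise below. *)
have Vle : ((trunc_log 2 k + 5) ^ 4)%:R <= 2 ^+ 8 * y ^+ 20.
  have le : (trunc_log 2 k + 5)%:R <= 4 * y.
    have le := trunc_log_le_ln R k_gt0; rewrite -/y in le.
    apply: le_trans (_ : (2 * trunc_log 2 k)%:R <= _); last by rewrite natrM; lra.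
    by rewrite ler_nat mul2n -addnn leq_add2l (leq_trans _ k13).
  rewrite natrX; apply: le_trans (_ : (4 * y) ^+ 4 <= _).
    by apply: lerXn2r; rewrite ?nnegrE // mulr_ge0 ?ltW.
  rewrite exprMn (_ : 4 ^+ 4 = 2 ^+ 8); last by lra.
  by apply: ler_wpM2l; rewrite ?exprn_ge0 // ler_weXn2l.
have lle : ((trunc_log 2 (r * k) + 3) ^ 6)%:R <= 2 ^+ 24 * x ^+ 20.
  (* Here [2(x + y) + 3 <= 8x + 3 <= 16x]. *)
  have le : (trunc_log 2 (r * k) + 3)%:R <= 16 * x.
    have le := trunc_log_le_ln R (n := r * k).
    rewrite muln_gt0 r_gt0 k_gt0 natrM lnM ?posrE // -/x -/y in le.
    by rewrite natrD; have := le isT; lra.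
  rewrite natrX; apply: le_trans (_ : (16 * x) ^+ 6 <= _).
    by apply: lerXn2r; rewrite ?nnegrE // mulr_ge0 ?ltW.
  rewrite exprMn (_ : 16 ^+ 6 = 2 ^+ 24); last by rewrite (_ : 16 = 2 ^+ 4) -?exprM //; lra.
  by apply: ler_wpM2l; rewrite ?exprn_ge0 // ler_weXn2l.
have Yle := root_bound R r_gt0 k15 Y_gt1 Yh.
have powE : (r%:R : R) `^ (2 + 30 / k%:R) = r%:R ^+ 2 * r%:R `^ (30 / k%:R).
  by rewrite powRD ?powR_mulrn // (gt_eqF rR) implybT.
rewrite powE; set z := _ `^ _ in Yle *.
have z_ge0 : 0 <= z by exact: powR_ge0.
apply: le_trans (_ : (2 ^ 14 * r ^ 2 * k ^ 2 * (trunc_log 2 k + 5) ^ 4 *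
             (trunc_log 2 (r * k) + 3) ^ 6 * Y ^ 2)%N%:R <= _).
  by rewrite ler_nat (leq_trans dP).
rewrite (natrM _ _ (Y ^ 2)) (natrM _ _ (_ ^ 6)) (natrM _ _ (_ ^ 4)).
apply: le_trans (_ : (2 ^ 14 * r ^ 2 * k ^ 2)%:R * (2 ^+ 8 * y ^+ 20) *
  (2 ^+ 24 * x ^+ 20) * (2 ^+ 10 * z) <= _).
  apply: ler_pM Yle; [by rewrite -!natrM ler0n|by rewrite ler0n|].
  apply: ler_pM lle; [by rewrite -!natrM ler0n|by rewrite ler0n|].
  by apply: ler_wpM2l Vle; rewrite ler0n.
rewrite (natrM _ _ (k ^ 2)) (natrM _ _ (r ^ 2)).
rewrite !natrX.
have -> : 2 ^+ 14 * r%:R ^+ 2 * k%:R ^+ 2 * (2 ^+ 8 * y ^+ 20) * (2 ^+ 24 * x ^+ 20) *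
    (2 ^+ 10 * z) = 2 ^+ (14 + 8 + 24 + 10) * (k%:R ^+ 2 * (r%:R ^+ 2 * z) * x ^+ 20 * y ^+ 20).
  rewrite !exprD; move: (2 ^+ 14) (2 ^+ 8) (2 ^+ 24) (2 ^+ 10) (x ^+ 20) (y ^+ 20) => *.
  by ring.
have -> : 2 ^+ 400 * k%:R ^+ 2 * (r%:R ^+ 2 * z) * x ^+ 20 * y ^+ 20 =
    2 ^+ 400 * (k%:R ^+ 2 * (r%:R ^+ 2 * z) * x ^+ 20 * y ^+ 20).
  by move: (2 ^+ 400) (x ^+ 20) (y ^+ 20) => *; ring.
(* The collected constant is only [2^56]. *)
apply: ler_wpM2r; last by apply: ler_weXn2l; rewrite ?ler1n.
by rewrite !mulr_ge0 ?exprn_ge0 ?(ltW rR) ?(ltW kR) ?(ltW x_gt0) ?(ltW y_gt0).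
Qed.
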